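(* For each $n$ suppose we observe $y\sim\mathrm{N}_n(\theta_0,\mathrm{I}_n)$, and the normal means model $y_i=\theta_i+\epsilon_i$, $\epsilon_i\sim\mathrm{N}(0,1)$ independently, $1\le i\le n$, is fitted with the following global-local prior on $\theta=(\theta_1,\dots,\theta_n)$: given $\tau$ and $\psi=(\psi_1,\dots,\psi_n)$, $\theta_j\sim\mathrm{N}(0,\psi_j\tau)$ independently; the local scales $\psi_j$ are i.i.d. with distribution $g\equiv\mathrm{Exp}(\lambda)$ for some constant $\lambda>0$; and, independently, $\tau$ has density $f\in\mathcal{F}$. Assume $\theta_0\in l_0[q_n;n]$ with $q_n=1$ and $\|\theta_0\|_2^2/\log n\to\infty$. Then $$\mathbb{E}_{n,\theta_0}\,\mathbb{P}(\|\theta-\theta_0\|_2\le\sqrt{\log n}\mid y)\to0\quad\text{as } n\to\infty.$$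
   Context: $\|\cdot\|_2$ is the Euclidean norm; $\mathrm{N}(0,v)$ is the normal distribution with variance $v$; $\mathrm{Exp}(\lambda)$ is the exponential distribution with rate $\lambda$. $\theta_0=\theta_0^{(n)}\in\mathbb{R}^n$ is a sequence of true parameters, and $l_0[q;n]=\{\theta\in\mathbb{R}^n:\#\{1\le j\le n:\theta_j\ne0\}\le q\}$. The class $\mathcal{F}$ consists of the probability densities $f$ on $(0,\infty)$ for which there is a constant $M>0$ with (i) $f(\tau)\le M$ for all $\tau\in(0,\infty)$, and (ii) $f(\tau)>1/M$ for all $\tau\in(0,1)$; $f$ and $\lambda$ do not depend on $n$. $\mathbb{P}(\cdot\mid y)$ is the posterior distribution of $\theta$ given $y$ under the fitted model and prior, and $\mathbb{E}_{n,\theta_0}$ is expectation over $y\sim\mathrm{N}_n(\theta_0,\mathrm{I}_n)$. *)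

(* Defs.v *)
From HB Require Import structures.
From mathcomp Require Import all_boot all_order all_algebra.
From mathcomp Require Import all_classical all_reals all_analysis.
From mathcomp Require Import measurable_realfun giry.

Set Implicit Arguments.
Unset Strict Implicit.
Unset Printing Implicit Defensive.

Import Order.TTheory GRing.Theory Num.Theory.
Import numFieldNormedType.Exports.

Local Open Scope classical_set_scope.
Local Open Scope ring_scope.

(* Points of R^n are tuples: unlike row vectors, they carry the product
   sigma-algebra in the library. The carrier measurableTypeR R is R with the
   Borel sigma-algebra, under the display with which lebesgue_measure,
   normal_prob and exponential_prob are declared. *)
Notation vec R n := (n.-tuple (measurableTypeR R)).

Definition norm2 (R : realType) n (x : vec R n) : R :=
  Num.sqrt (\sum_(i < n) tnth x i ^+ 2).

Definition subt (R : realType) n (x y : vec R n) : vec R n :=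
  [tuple tnth x i - tnth y i | i < n].

Definition l0_ball (R : realType) (q n : nat) : set (vec R n) :=
  [set x | (#|[set j : 'I_n | tnth x j != 0%R]%SET| <= q)%N].
Arguments l0_ball {R} q n.

(* The values of f outside `]0, +oo[ are irrelevant. *)
Definition density_class (R : realType) (f : R -> R) : Prop :=
  [/\ measurable_fun (`]0, +oo[ : set R) f,
      forall t, 0 < t -> 0 <= f t,
      (\int[lebesgue_measure]_(t in `]0%R, +oo[) (f t)%:E = 1)%E &
      exists M : R, [/\ 0 < M,
        forall t, 0 < t -> f t <= M &
        forall t, 0 < t < 1 -> M^-1 < f t]].

Section product_probability.
Context d (T : measurableType d) (R : realType).

Definition tuple_cons n (x : T * n.-tuple T) : n.+1.-tuple T :=
  [the n.+1.-tuple T of x.1 :: x.2].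

Lemma measurable_tuple_cons n : measurable_fun setT (@tuple_cons n).
Proof. exact: measurable_cons. Qed.

HB.instance Definition _ n := isMeasurableFun.Build _ _ _ _ (@tuple_cons n)
  (@measurable_tuple_cons n).

(* joint law of n independent coordinates with respective laws P i *)
Fixpoint prod_prob n : ('I_n -> probability T R) -> probability (n.-tuple T) R :=
  match n with
  | 0 => fun _ => \d_([tuple] : 0.-tuple T)
  | m.+1 => fun P =>
      distribution (P ord0 \x prod_prob (fun i => P (lift ord0 i)))%E
        (@tuple_cons m)
  end.

Lemma prod_probE n (P : 'I_n -> probability T R) (B : 'I_n -> set T) :
  (forall i, measurable (B i)) ->
  prod_prob P [set x | forall i, B i (tnth x i)] = (\prod_(i < n) P i (B i))%E.
Proof.
elim: n P B => [|n IH] P B mB.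
  rewrite big_ord0 /= (_ : [set _ | _] = setT) ?diracT//.
  by apply/seteqP; split => // x _ [].
rewrite big_ord_recl /= -IH// /distribution /pushforward.
rewrite (_ : _ @^-1` _ =
  B ord0 `*` [set x : n.-tuple T | forall i, B (lift ord0 i) (tnth x i)]).
  rewrite product_measure1E//.
  rewrite (_ : [set x | _] =
    \bigcap_(i in [set: 'I_n]) ((@tnth _ T ^~ i) @^-1` B (lift ord0 i))).
    apply: fin_bigcap_measurable => [|i _]; first exact: finite_finset.
    by rewrite -[_ @^-1` _]setTI; exact: measurable_tnth.
  by apply/seteqP; split => [x Bx i _|x Bx i]; exact: Bx.
apply/seteqP; split => [[a x]/= Bx|[a x]/= [Ba Bx] i].
  split => [|i]/=; first exact: (Bx ord0).
  by have := Bx (lift ord0 i); rewrite tnthS.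
have [j ->|->] := unliftP ord0 i; last by [].
by rewrite tnthS; exact: Bx.
Qed.

Lemma measurable_prod_prob d' (X : measurableType d') n
    (P : X -> 'I_n -> probability T R) :
  (forall i B, measurable B -> measurable_fun [set: X] (fun x => P x i B)) ->
  forall A, measurable A -> measurable_fun [set: X] (fun x => prod_prob (P x) A).
Proof.
elim: n P => [|n IH] P mP A mA; first exact: measurable_cst.
rewrite /= /distribution /pushforward.
set C := _ @^-1` A.
have mC : measurable C.
  by rewrite -[C]setTI; exact: measurable_tuple_cons.
pose p x : giry T R * giry (n.-tuple T) R :=
  (P x ord0 : giry T R,
   prod_prob (fun i => P x (lift ord0 i)) : giry (n.-tuple T) R).
have mp : measurable_fun setT p.
  apply: measurable_fun_pair => /=.
    by apply: measurable_giry_codensity => // B mB; exact: mP.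
  by apply: measurable_giry_codensity => // B mB; apply: IH => // i; exact: mP.
have := measurableT_comp (measurable_giry_ev mC)
  (measurableT_comp measurable_giry_prod mp).
exact.
Qed.

End product_probability.

Section mixture.
Context d d' (X : measurableType d) (Y : measurableType d') (R : realType).
Variables (P : probability X R) (k : R.-pker X ~> Y).

(* law of y when x ~ P and, given x, y ~ k x *)
Definition mixture (A : set Y) : \bar R := (\int[P]_x k x A)%E.

Let mixture0 : mixture set0 = 0%E.
Proof. by rewrite /mixture integral0_eq. Qed.

Let mixture_ge0 A : (0 <= mixture A)%E.
Proof. exact: integral_ge0. Qed.

Let mixture_sigma_additive : semi_sigma_additive mixture.
Proof.
move=> F mF tF mUF; rewrite /mixture.
rewrite (_ : (\int[P]_x _)%E = (\sum_(i <oo) \int[P]_x k x (F i))%E).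
  by apply: is_cvg_ereal_nneg_natsum => i _; exact: integral_ge0.
rewrite -integral_nneseries//; last by move=> i; exact: measurable_kernel.
by apply: eq_integral => x _; rewrite measure_semi_bigcup.
Qed.

HB.instance Definition _ := isMeasure.Build _ _ _ mixture
  mixture0 mixture_ge0 mixture_sigma_additive.

Let mixture_setT : mixture setT = 1%E.
Proof.
rewrite /mixture; under eq_integral do rewrite prob_kernel.
by rewrite integral_cst// mul1e; exact: probability_setT.
Qed.

HB.instance Definition _ := Measure_isProbability.Build _ _ _ mixture
  mixture_setT.

End mixture.

Section global_local_prior.
Context (R : realType).

Let measurable_invr : measurable_fun [set: R] (@GRing.inv R).
Proof.
rewrite (_ : @GRing.inv R = (fun x => x * (x ^+ 2) `^ (-1))).
  apply: measurable_funM => //.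
  have h := measurableT_comp (@measurable_powR R (-1))
    (measurable_funX 2 (@measurable_id _ R setT)).
  exact: h.
apply/funext => x; rewrite powR_inv1 ?sqr_ge0//.
have [->|x0] := eqVneq x 0; first by rewrite mul0r invr0.
by rewrite expr2 invfM mulrA divff// mul1r.
Qed.

Let measurable_sqrtr : measurable_fun [set: R] (@Num.sqrt R).
Proof. by apply: continuous_measurable_fun => x; exact: sqrt_continuous. Qed.

Lemma measurable_normal_prob_sd (B : set R) : measurable B ->
  measurable_fun [set: measurableTypeR R] (fun s => normal_prob 0 s B).
Proof.
move=> mB; rewrite /normal_prob.
under eq_fun do rewrite integral_mkcond.
have mpdf : measurable_fun [set: R * R]
    (fun z : R * R => normal_pdf 0 z.1 z.2).
  have ms2 : measurable_fun [set: R * R] (fun z : R * R => z.1 ^+ 2).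
    exact: measurable_funX.
  rewrite /normal_pdf; apply: measurable_fun_ifT => /=.
  - exact: measurable_fun_eqr.
  - apply: measurableT_comp; last exact: measurable_snd.
    exact: measurable_indic.
  - apply: measurable_funM.
      apply: (measurableT_comp measurable_invr).
      apply: (measurableT_comp measurable_sqrtr).
      under eq_fun do rewrite -mulr_natr.
      by apply: measurable_funM => //; exact: measurable_funM.
    apply: (measurableT_comp (@measurable_expR R)).
    apply: measurable_funM.
      apply: measurableT_comp => //; apply: measurable_funX.
      by apply: measurable_funB.
    apply: (measurableT_comp measurable_invr).
    under eq_fun do rewrite -mulr_natr.
    exact: measurable_funM.
pose h : R * R -> \bar R :=
  (fun z => (normal_pdf 0 z.1 z.2)%:E) \_ (setT `*` B).
have mh : measurable_fun [set: R * R] h.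
  apply/(measurable_restrictT _ (measurableX measurableT mB)).
  by apply: measurable_funTS; exact/measurable_EFinP.
have h0 z : (0 <= h z)%E.
  by rewrite /h patchE; case: ifP => // _; rewrite lee_fin normal_pdf_ge0.
have mF := @measurable_fun_fubini_tonelli_F _ _ (measurableTypeR R)
  (measurableTypeR R) R lebesgue_measure h mh h0.
apply: (eq_measurable_fun _ _ mF) => s _; rewrite /fubini_F.
apply: eq_integral => x _; rewrite /h !patchE.
by rewrite in_setX in_setT.
Qed.

(* Law of theta given (tau, psi): independent coordinates N(0, psi_j * tau),
   normal_prob taking the standard deviation. For psi_j * tau <= 0 it gets
   standard deviation 0 and is a placeholder; this event is negligible when g
   and the law of tau do not charge `]-oo, 0]. *)
Definition gl_kernel n (s : measurableTypeR R * vec R n) :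
    {measure set (vec R n) -> \bar R} :=
  prod_prob (fun j => normal_prob 0 (Num.sqrt (tnth s.2 j * s.1))).

Lemma measurable_gl_kernel n (A : set (vec R n)) : measurable A ->
  measurable_fun [set: measurableTypeR R * vec R n] (fun s => @gl_kernel n s A).
Proof.
move=> mA; apply: measurable_prod_prob => // j B mB.
apply: (measurableT_comp (measurable_normal_prob_sd mB)).
apply: (measurableT_comp measurable_sqrtr).
apply: measurable_funM => //.
exact: (measurableT_comp (@measurable_tnth _ (measurableTypeR R) n j)
  measurable_snd).
Qed.

HB.instance Definition _ n := isKernel.Build _ _ _ _ R (@gl_kernel n)
  (@measurable_gl_kernel n).

Let gl_kernel_setT n s : @gl_kernel n s setT = 1%E.
Proof. exact: probability_setT. Qed.

HB.instance Definition _ n := Kernel_isProbability.Build _ _ _ _ R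
  (@gl_kernel n) (@gl_kernel_setT n).

Definition gl_prior (P_tau g : probability (measurableTypeR R) R) n :
    probability (vec R n) R :=
  mixture (P_tau \x prod_prob (fun _ : 'I_n => g))%E (@gl_kernel n).

End global_local_prior.

Section normal_means.
Context (R : realType) (n : nat).

(* N_n(theta, I_n) *)
Definition normal_means (theta : vec R n) : probability (vec R n) R :=
  prod_prob (fun i => normal_prob (tnth theta i) 1).

Definition likelihood (y theta : vec R n) : R :=
  \prod_(i < n) normal_pdf (tnth theta i) 1 (tnth y i).

Lemma likelihood_gt0 y theta : 0 < likelihood y theta.
Proof.
apply: prodr_gt0 => i _; rewrite normal_pdfE ?oner_neq0//.
by rewrite mulr_gt0 ?expR_gt0// normal_peak_gt0 ?oner_neq0.
Qed.

Lemma likelihood_ge0 y theta : 0 <= likelihood y theta.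
Proof. exact/ltW/likelihood_gt0. Qed.

Lemma likelihood_ub y theta : likelihood y theta <= normal_peak 1 ^+ n.
Proof.
rewrite -[n in leRHS]card_ord -prodr_const; apply: ler_prod => i _.
by rewrite normal_pdf_ge0 normal_pdf_ub ?oner_neq0.
Qed.

Lemma measurable_likelihood y :
  measurable_fun [set: vec R n] (likelihood y).
Proof.
apply: measurable_prod => i _.
rewrite (_ : (fun _ => _) = normal_pdf (tnth y i) 1 \o (@tnth n R ^~ i)).
  apply: measurableT_comp; first exact: measurable_normal_pdf.
  exact: measurable_tnth.
apply/funext => t /=; rewrite !normal_pdfE ?oner_neq0// /normal_fun.
by rewrite -sqrrN opprB.
Qed.

Section posterior.
Variables (prior : probability (vec R n) R) (y : vec R n).

(* integral of the likelihood against the prior: numerator of Bayes' formula *)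
Definition bayes_mass (A : set (vec R n)) : \bar R :=
  (\int[prior]_(theta in A) (likelihood y theta)%:E)%E.

Let bayes_mass0 : bayes_mass set0 = 0%E.
Proof. exact: integral_set0. Qed.

Let bayes_mass_ge0 A : (0 <= bayes_mass A)%E.
Proof. by apply: integral_ge0 => t _; rewrite lee_fin likelihood_ge0. Qed.

Let bayes_mass_sigma_additive : semi_sigma_additive bayes_mass.
Proof.
move=> F mF tF mUF; rewrite /bayes_mass ge0_integral_bigcup//.
- by apply: is_cvg_ereal_nneg_natsum => i _; exact: bayes_mass_ge0.
- by apply: measurable_funTS; apply/measurable_EFinP; exact: measurable_likelihood.
- by move=> t _; rewrite lee_fin likelihood_ge0.
Qed.

HB.instance Definition _ := isMeasure.Build _ _ _ bayes_mass
  bayes_mass0 bayes_mass_ge0 bayes_mass_sigma_additive.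

(* The fallback argument of mnormalize is never used, see posteriorE. *)
Definition posterior : probability (vec R n) R :=
  mnormalize bayes_mass prior.

Lemma posteriorE A :
  [/\ (0 < bayes_mass setT)%E, (bayes_mass setT < +oo)%E &
      posterior A = (bayes_mass A * (fine (bayes_mass setT))^-1%:E)%E].
Proof.
have mL : measurable_fun [set: vec R n] (fun t => (likelihood y t)%:E).
  by apply/measurable_EFinP; exact: measurable_likelihood.
have m1 : (0 < bayes_mass setT)%E.
  rewrite lt0e bayes_mass_ge0 andbT; apply/eqP => m0.
  have /(ae_eq_integral_abs prior measurableT mL)[N [mN N0 sN]] :
      (\int[prior]_t `|(likelihood y t)%:E| = 0)%E.
    rewrite -[RHS]m0; apply: eq_integral => t _.
    by rewrite gee0_abs// lee_fin likelihood_ge0.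
  suff NT : N = setT.
    have := @probability_setT _ _ _ prior; rewrite -NT N0 => /esym/eqP.
    by rewrite onee_eq0.
  apply/seteqP; split => // t _; apply: sN => /= /(_ I) [] /eqP.
  by rewrite gt_eqF// likelihood_gt0.
have m2 : (bayes_mass setT < +oo)%E.
  apply: (@le_lt_trans _ _ (\int[prior]_t (normal_peak 1 ^+ n)%:E)%E).
    apply: ge0_le_integral => //.
    - by move=> t _; rewrite lee_fin likelihood_ge0.
    - by move=> t _; rewrite lee_fin likelihood_ub.
  rewrite integral_cst// [X in (_ * X)%E](_ : _ = 1%E) ?mule1 ?ltry//.
  exact: probability_setT.
split => //; rewrite /posterior/= /mnormalize.
by rewrite gt_eqF//= lt_eqF.
Qed.

End posterior.
End normal_means.

(* Main.v *)
From HB Require Import structures.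
Require Import Defs.
From mathcomp Require Import all_boot all_order all_algebra.
From mathcomp Require Import all_classical all_reals all_analysis.
From mathcomp Require Import measurable_realfun giry ring lra.

Import Order.TTheory GRing.Theory Num.Theory.
Import numFieldNormedType.Exports.

Local Open Scope classical_set_scope.
Local Open Scope ring_scope.

(* Let k carry the nonzero entry T of theta0, L = ln n, and split the posterior
   mass of the ball according to whether tau exceeds t1 = C L / n.

   If tau > t1, the prior spreads the n - 1 null coordinates too much: asking
   \sum_(j != k) theta_j^2 <= L costs, relative to the marginal likelihood
   given tau, a factor less than 1 for every j with |y_j| <= 1. For C large the
   product of these factors beats the constant exp(3 L / t1).

   If tau <= t1, the ball forces |theta_k| >= |T| / 2, whose prior probability
   is at most exp(-c |T| sqrt (n / L)) because psi_k has exponential tails. The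
   evidence is bounded below, relative to the likelihood at theta0, by
   restricting tau to an interval around K L / n, psi_j for j != k to
   O(log n), and psi_k to an interval around |T| / sqrt (K L / n); for K large
   the loss is of smaller order, since |T|^2 / L -> oo. The ratio of the
   likelihoods at theta and at theta0 has expectation 1, so Fubini's theorem
   turns these two estimates into a bound on the expected posterior mass. *)

(** The obstacle is that the posterior is a quotient of two random integrals. For large tau the
    numerator is bounded by a random multiple of the evidence itself, so the quotient needs no lower
    bound there. For small tau the evidence is bounded below by a deterministic constant times the
    likelihood at theta0, off an event where y_k is far from T; the quotient then becomes a
    likelihood ratio, whose expectation is computable.

    The natural unit is x = |T| sqrt (n / L). Reaching T costs lambda psi_k in the exponential law
    and order T^2 / (psi_k tau) in the Gaussian one. For tau = C L / n the sum is least at psi_k of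
    order x / sqrt C, where it is of order x / sqrt C too. Hence, with K large against C, reaching T
    with tau near K L / n is exponentially likelier, in x, than with tau <= C L / n. The price paid
    by the null coordinates for the larger tau is only exp(O(L^2)), and x >= sqrt n dwarfs L^2. *)

(** * Integration *)

(* Unlike [ge0_le_integral], the smaller function need not be measurable. *)
Lemma le_integral_ge0 {d} {T : measurableType d} {R : realType}
    (mu : {measure set T -> \bar R}) (f1 f2 : T -> \bar R) :
  (forall x, 0 <= f1 x)%E -> (forall x, f1 x <= f2 x)%E ->
  (\int[mu]_x f1 x <= \int[mu]_x f2 x)%E.
Proof.
move=> f10 f12; have f20 x : (0 <= f2 x)%E by exact: le_trans (f12 x).
rewrite !ge0_integralTE//; apply: le_ereal_sup => _ [h hf1 <-]; exists h => //.
by move=> x; exact: le_trans (f12 x).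
Qed.

Section density.
Import HBNNSimple.

(** Holds for indicators by assumption, for simple functions by finite sums, and in general by
    monotone convergence on both sides. *)
Lemma integral_density {d} {T : measurableType d} {R : realType}
    (mu nu : {measure set T -> \bar R}) (p : T -> R) (f : T -> \bar R) :
  measurable_fun setT p -> (forall x, 0 <= p x) ->
  (forall A, measurable A -> nu A = (\int[mu]_(x in A) (p x)%:E)%E) ->
  measurable_fun setT f -> (forall x, 0 <= f x)%E ->
  (\int[nu]_x f x = \int[mu]_x (f x * (p x)%:E))%E.
Proof.
move=> mp p0 nuE mf f0.
have mpE : measurable_fun setT (EFin \o p) by exact/measurable_EFinP.
have ind A : measurable A ->
    (\int[mu]_x ((\1_A x)%:E * (p x)%:E) = nu A)%E.
  move=> mA; rewrite nuE// [RHS]integral_mkcond; apply: eq_integral => x _.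
  by rewrite patchE indicE; case: (x \in A); rewrite ?mul1e ?mul0e.
pose f_ := nnsfun_approx measurableT mf.
transitivity (limn (fun n => \int[nu]_x (f_ n x)%:E)%E).
  rewrite -monotone_convergence//; last 3 first.
  - by move=> n; exact/measurable_EFinP.
  - by move=> n y _; rewrite lee_fin.
  - by move=> y _ m n mn; rewrite lee_fin; exact/lefP/nd_nnsfun_approx.
  by apply: eq_integral => y _; apply/esym/cvg_lim => //;
    exact: cvg_nnsfun_approx.
transitivity (limn (fun n => \int[mu]_x ((f_ n x)%:E * (p x)%:E))%E); last first.
  rewrite -monotone_convergence//; last 3 first.
  - move=> n; apply: emeasurable_funM => //; exact/measurable_EFinP.
  - by move=> n y _; rewrite mule_ge0// lee_fin.
  - move=> y _ m n mn; rewrite lee_wpmul2r// lee_fin//.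
    exact/lefP/nd_nnsfun_approx.
  apply: eq_integral => y _; apply/cvg_lim => //; apply: cvgeZr => //.
  exact: cvg_nnsfun_approx.
congr (limn _); apply/funext => n.
rewrite integralT_nnsfun sintegralE.
have sumE x : ((f_ n x)%:E * (p x)%:E =
    \sum_(r \in range (f_ n)) ((r * \1_(f_ n @^-1` [set r]) x)%:E * (p x)%:E))%E.
  rewrite fimfunE -fsumEFin// ge0_mule_fsuml// => r.
  by rewrite EFinM nnfun_muleindic_ge0.
under [RHS]eq_integral do rewrite sumE.
rewrite ge0_integral_fsum//; last 2 first.
- move=> r; apply: emeasurable_funM => //.
  by apply/measurable_EFinP/measurable_funM.
- by move=> r z _; rewrite mule_ge0 ?lee_fin// -lee_fin EFinM nnfun_muleindic_ge0.
apply: eq_fsbigr => r _.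
(* A scalar can be pulled out only if it is nonnegative; for negative [r] the level set of the
   nonnegative [f_ n] is empty and both sides vanish. *)
have [r0|r0] := leP 0 r.
  under eq_integral do rewrite EFinM -muleA.
  rewrite ge0_integralZl//.
  - by rewrite ind.
  - apply: emeasurable_funM => //; exact/measurable_EFinP.
  - by move=> x _; rewrite mule_ge0// lee_fin.
rewrite preimage_nnfun0// measure0 mule0 integral0_eq// => x _.
by rewrite indic0 mulr0 mul0e.
Qed.

End density.

(** A mixture is the bind of the Giry monad, and integration against a bind is an iterated integral.
    [Q] is [k] with its values bundled as probabilities, as a map into [giry Y R] requires. *)
Lemma integral_mixture {d d'} {X : measurableType d} {Y : measurableType d'}
    {R : realType} (P : probability X R) (k : R.-pker X ~> Y)
    (Q : X -> probability Y R) (f : Y -> \bar R) :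
  (forall x, k x = Q x :> (set Y -> \bar R)) ->
  measurable_fun setT f -> (forall y, 0 <= f y)%E ->
  (\int[mixture P k]_y f y = \int[P]_x \int[Q x]_y f y)%E.
Proof.
move=> kQ mf f0.
have mQ : measurable_fun [set: X] (fun x => Q x : giry Y R).
  apply: measurable_giry_codensity => // B mB.
  by under eq_fun do rewrite /= -kQ; exact: measurable_kernel.
have := giry_int_bind (P : giry X R) mQ mf f0; rewrite /giry_int => <-.
apply: eq_measure_integral => A mA _ /=.
rewrite /mixture/= /giry_join/= /giry_int ge0_integral_pushforward//;
  last exact: measurable_giry_ev.
by apply: eq_integral => x _ /=; rewrite kQ.
Qed.

Lemma measurable_prode {d} {T : measurableType d} {R : realType} n
    (D : set T) (h : 'I_n -> T -> \bar R) :
  (forall i, measurable_fun D (h i)) ->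
  measurable_fun D (fun x => \prod_(i < n) h i x)%E.
Proof.
elim: n h => [|n IH] h mh.
  by under eq_fun do rewrite big_ord0; exact: measurable_cst.
under eq_fun do rewrite big_ord_recl; apply: emeasurable_funM => //.
by apply: IH => i.
Qed.

Lemma measurable_prod_tnth {d} {T : measurableType d} {R : realType} n
    (h : 'I_n -> T -> \bar R) :
  (forall i, measurable_fun setT (h i)) ->
  measurable_fun setT (fun x : n.-tuple T => \prod_(i < n) h i (tnth x i))%E.
Proof.
move=> mh; apply: measurable_prode => i.
by apply: (measurableT_comp (mh i)); exact: measurable_tnth.
Qed.

(** Tonelli's theorem along the recursion that defines [prod_prob]. All reductions to a single
    coordinate rest on it. *)
Lemma integral_prod_prob {d} {T : measurableType d} {R : realType} n
    (P : 'I_n -> probability T R) (h : 'I_n -> T -> \bar R) :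
  (forall i, measurable_fun setT (h i)) -> (forall i x, 0 <= h i x)%E ->
  (\int[prod_prob P]_x \prod_(i < n) h i (tnth x i) =
   \prod_(i < n) \int[P i]_x h i x)%E.
Proof.
elim: n P h => [|n IH] P h mh h0.
  by rewrite big_ord0 /= integral_dirac ?big_ord0 ?diracT ?mul1e//;
    under eq_fun do rewrite big_ord0; exact: measurable_cst.
rewrite big_ord_recl /= ge0_integral_distribution; last 2 first.
- exact: measurable_prod_tnth.
- by move=> y; exact: prode_ge0.
rewrite -IH//.
pose F (x : T * n.-tuple T) :=
  (h ord0 x.1 * \prod_(i < n) h (lift ord0 i) (tnth x.2 i))%E.
transitivity (\int[P ord0 \x prod_prob (fun i => P (lift ord0 i))]_x F x)%E.
  apply: eq_integral => x _ /=; rewrite big_ord_recl /=; congr (_ * _)%E.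
  by apply: eq_bigr => i _; rewrite tnthS.
have mp : measurable_fun setT
    (fun x : n.-tuple T => \prod_(i < n) h (lift ord0 i) (tnth x i))%E.
  by apply: (@measurable_prod_tnth _ _ _ _ (fun i => h (lift ord0 i))) => i.
have p0 (x : n.-tuple T) : (0 <= \prod_(i < n) h (lift ord0 i) (tnth x i))%E.
  exact: prode_ge0.
rewrite fubini_tonelli1//; last 2 first.
- apply: emeasurable_funM; first exact: measurableT_comp.
  exact: (measurableT_comp mp).
- by move=> x; rewrite mule_ge0.
rewrite -ge0_integralZr ?integral_ge0//.
by apply: eq_integral => x _; rewrite /fubini_F /F/= ge0_integralZl.
Qed.

(** * Gaussian densities *)

Lemma measurable_dist_ge {R : realType} (u c : R) :
  measurable [set x : measurableTypeR R | c <= `|x - u|].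
Proof.
have mh : measurable_fun setT (fun x : R => `|x - u|).
  by apply: measurableT_comp => //; exact: measurable_funB.
rewrite (_ : [set x | _] = setT `&` (fun x : R => `|x - u|) @^-1` `[c, +oo[).
  exact: mh.
apply/seteqP; split => x; rewrite /= in_itv/= andbT; first by split.
by case.
Qed.

Section gaussian.
Context {R : realType}.
Implicit Types m s u v x y th : R.

(** Parametrised by the variance, because the scales enter as the variance [psi * t] and
    marginalisation adds variances. *)
Definition gauss_pdf m v x : R := normal_pdf m (Num.sqrt v) x.

Lemma gauss_pdfE m v x : 0 < v ->
  gauss_pdf m v x =
  normal_peak 1 * (Num.sqrt v)^-1 * expR (- (x - m) ^+ 2 / (2 * v)).
Proof.
move=> v0; have sv0 : Num.sqrt v != 0 by rewrite gt_eqF// sqrtr_gt0.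
rewrite /gauss_pdf normal_pdfE// /normal_peak /normal_fun sqr_sqrtr ?ltW//.
rewrite expr1n mul1r; congr (_ * _).
  by rewrite -mulrnAr sqrtrM ?ltW// invfM mulrC.
by rewrite mulr_natl.
Qed.

Lemma gauss_pdf_ge0 m v x : 0 <= gauss_pdf m v x.
Proof. exact: normal_pdf_ge0. Qed.

Lemma gauss_pdf_sym m v x : 0 < v -> gauss_pdf m v x = gauss_pdf x v m.
Proof. by move=> v0; rewrite !gauss_pdfE// -sqrrN opprB. Qed.

Lemma measurable_gauss_pdf m v : measurable_fun setT (gauss_pdf m v).
Proof. exact: measurable_normal_pdf. Qed.

Lemma measurable_gauss_pdf_mean v x :
  0 < v -> measurable_fun setT (fun m => gauss_pdf m v x).
Proof.
move=> v0; rewrite (_ : (fun m => _) = gauss_pdf x v).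
  exact: measurable_gauss_pdf.
by apply/funext => m; rewrite gauss_pdf_sym.
Qed.

Lemma integral_normal_prob m v (f : R -> \bar R) :
  measurable_fun setT f -> (forall x, 0 <= f x)%E ->
  (\int[normal_prob m (Num.sqrt v)]_x f x =
   \int[lebesgue_measure]_x (f x * (gauss_pdf m v x)%:E))%E.
Proof.
move=> mf f0; apply: integral_density => //; first exact: measurable_normal_pdf.
by move=> x; exact: normal_pdf_ge0.
Qed.

(* Multiplying a Gaussian density by a Gaussian weight changes its variance:
   the weight has exponent [s^-1 - v^-1] over 2. *)
Lemma gauss_pdf_tilt m s v x : 0 < s -> 0 < v ->
  expR (- (v^-1 - s^-1) / 2 * (x - m) ^+ 2) * gauss_pdf m s x =
  Num.sqrt (v / s) * gauss_pdf m v x.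
Proof.
move=> s0 v0; rewrite !gauss_pdfE//.
have sv0 : Num.sqrt v != 0 by rewrite gt_eqF// sqrtr_gt0.
rewrite sqrtrM ?ltW// sqrtrV ?ltW//.
have -> : expR (- (x - m) ^+ 2 / (2 * v)) =
    expR (- (v^-1 - s^-1) / 2 * (x - m) ^+ 2) * expR (- (x - m) ^+ 2 / (2 * s)).
  by rewrite -expRD; congr expR; field; rewrite !gt_eqF.
rewrite [RHS](_ : _ = normal_peak 1 * (Num.sqrt s)^-1 *
  (Num.sqrt v / Num.sqrt v) * (expR (- (v^-1 - s^-1) / 2 * (x - m) ^+ 2)
  * expR (- (x - m) ^+ 2 / (2 * s)))); last by ring.
rewrite divff//; ring.
Qed.

(** Completing the square in [x]: the joint density is the marginal density of [y] times the density
    of the conjugate posterior of [x]. *)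
Lemma gauss_pdf_bayes s x y : 0 < s ->
  gauss_pdf x 1 y * gauss_pdf 0 s x =
  gauss_pdf 0 (1 + s) y * gauss_pdf (y * s / (1 + s)) (s / (1 + s)) x.
Proof.
move=> s0; have s1 : 0 < 1 + s by rewrite addr_gt0.
rewrite !gauss_pdfE ?divr_gt0// sqrtr1 invr1 mulr1.
have -> : (Num.sqrt (s / (1 + s)))^-1 = (Num.sqrt s)^-1 * Num.sqrt (1 + s).
  by rewrite (sqrtrM _ (ltW s0)) sqrtrV ?ltW// invfM invrK.
have sv0 : Num.sqrt (1 + s) != 0 by rewrite gt_eqF// sqrtr_gt0.
set a := normal_peak 1; set b := (Num.sqrt s)^-1.
set r := Num.sqrt (1 + s).
rewrite [LHS](_ : _ = a * a * b *
  (expR (- (y - x) ^+ 2 / (2 * 1)) * expR (- (x - 0) ^+ 2 / (2 * s)))); last by ring.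
rewrite [RHS](_ : _ = a * a * b * (r^-1 * r) * (expR (- (y - 0) ^+ 2 / (2 * (1 + s))) *
  expR (- (x - y * s / (1 + s)) ^+ 2 / (2 * (s / (1 + s)))))); last by ring.
rewrite mulVf// mulr1 -!expRD.
have -> : - (y - x) ^+ 2 / 2 + - (x - 0) ^+ 2 / (2 * s) =
  - (y - 0) ^+ 2 / (2 * (1 + s)) +
  - (x - y * s / (1 + s)) ^+ 2 / (2 * (s / (1 + s))).
  by field; rewrite !gt_eqF.
by rewrite mulr1.
Qed.

Lemma integral_gauss_pdf m v : 0 < v ->
  (\int[lebesgue_measure]_x (gauss_pdf m v x)%:E = 1)%E.
Proof. by move=> v0; apply: integral_normal_pdf; rewrite gt_eqF// sqrtr_gt0. Qed.

Lemma gauss_marginal s y : 0 < s ->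
  (\int[normal_prob 0 (Num.sqrt s)]_x (gauss_pdf x 1 y)%:E =
   (gauss_pdf 0 (1 + s) y)%:E)%E.
Proof.
move=> s0.
rewrite integral_normal_prob; last 2 first.
- by apply/measurable_EFinP; apply: measurable_gauss_pdf_mean.
- by move=> x; rewrite lee_fin gauss_pdf_ge0.
under eq_integral do rewrite -EFinM gauss_pdf_bayes// EFinM.
rewrite ge0_integralZl//; last 3 first.
- by apply/measurable_EFinP; exact: measurable_gauss_pdf.
- by move=> x _; rewrite lee_fin gauss_pdf_ge0.
- by rewrite lee_fin gauss_pdf_ge0.
by rewrite integral_gauss_pdf ?mule1// divr_gt0// addr_gt0.
Qed.

(** The weight tilts the variance [s] to [v = s / (1 + 2 u s)] at the price sqrt (v / s). The
    resulting marginal, of variance [1 + v], is compared with that of variance [1 + s] by a second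
    tilt, whose exponential factor is at most 1 because [v <= s]; this makes the bound uniform in
    [y]. *)
Lemma gauss_marginal_weighted s u y : 0 < s -> 0 <= u ->
  (\int[normal_prob 0 (Num.sqrt s)]_x (expR (- u * x ^+ 2) * gauss_pdf x 1 y)%:E <=
   (Num.sqrt ((1 + s) / (1 + s + 2 * u * s)) * gauss_pdf 0 (1 + s) y)%:E)%E.
Proof.
move=> s0 u0.
pose v := s / (1 + 2 * u * s).
have us : 0 < 1 + 2 * u * s by rewrite ltr_pwDl// !mulr_ge0// ltW.
have v0 : 0 < v by rewrite divr_gt0.
have mf : measurable_fun setT (fun x : R => (expR (- u * x ^+ 2) * gauss_pdf x 1 y)%:E).
  apply/measurable_EFinP; apply: measurable_funM.
    by apply: measurableT_comp => //; exact: measurable_funM.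
  exact: measurable_gauss_pdf_mean.
have mg : measurable_fun setT (fun x : R => (gauss_pdf x 1 y)%:E).
  apply/measurable_EFinP.
  exact: measurable_gauss_pdf_mean.
have f0 x : (0 <= (gauss_pdf x 1 y)%:E)%E by rewrite lee_fin gauss_pdf_ge0.
rewrite integral_normal_prob//; last first.
  by move=> x; rewrite lee_fin mulr_ge0// ?gauss_pdf_ge0// expR_ge0.
have tilt x : ((expR (- u * x ^+ 2) * gauss_pdf x 1 y)%:E * (gauss_pdf 0 s x)%:E =
    (Num.sqrt (v / s))%:E * ((gauss_pdf x 1 y)%:E * (gauss_pdf 0 v x)%:E))%E.
  rewrite -!EFinM; congr EFin.
  rewrite mulrAC [RHS]mulrCA [RHS]mulrC; congr (_ * _).
  rewrite -gauss_pdf_tilt// subr0; congr (expR _ * _).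
  by rewrite /v; field; rewrite !gt_eqF.
under eq_integral do rewrite tilt.
have s1 : 0 < 1 + s by rewrite addr_gt0.
have v1 : 0 < 1 + v by rewrite addr_gt0.
rewrite ge0_integralZl//; last 2 first.
- by apply: emeasurable_funM => //; apply/measurable_EFinP; exact: measurable_gauss_pdf.
- by move=> x _; rewrite mule_ge0// lee_fin gauss_pdf_ge0.
rewrite -integral_normal_prob// gauss_marginal// -EFinM lee_fin.
have tl : expR (- ((1 + s)^-1 - (1 + v)^-1) / 2 * (y - 0) ^+ 2) * gauss_pdf 0 (1 + v) y =
    Num.sqrt ((1 + s) / (1 + v)) * gauss_pdf 0 (1 + s) y by exact: gauss_pdf_tilt.
have vs : v <= s.
  by rewrite ler_pdivrMr// ler_peMr ?(ltW s0)// lerDl !mulr_ge0// ltW.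
apply: (@le_trans _ _ (Num.sqrt (v / s) *
  (Num.sqrt ((1 + s) / (1 + v)) * gauss_pdf 0 (1 + s) y))).
  rewrite ler_wpM2l ?sqrtr_ge0// -tl ler_peMl ?gauss_pdf_ge0//.
  rewrite -[leLHS]expR0 ler_expR mulr_ge0 ?sqr_ge0// divr_ge0//.
  by rewrite opprB subr_ge0 lef_pV2 ?posrE// lerD2l.
rewrite mulrA -sqrtrM ?(divr_ge0 (ltW v0) (ltW s0))// ler_wpM2r ?gauss_pdf_ge0// le_eqVlt.
apply/orP; left; apply/eqP; congr Num.sqrt.
rewrite /v; field; rewrite !gt_eqF//.
by rewrite ltr_pwDl// !mulr_ge0// ltW.
Qed.

(** Compares with the density of variance [2 * s]: the quotient of the two is sqrt 2 * exp(- (y -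
    m)^2 / (4 s)), which is largest on the boundary of the tail. *)
Lemma gauss_tail m s x : 0 < s -> 0 <= x ->
  (normal_prob m (Num.sqrt s) [set th : R | (x <= `|th - m|)%R] <=
   (Num.sqrt 2 * expR (- x ^+ 2 / (4 * s)))%:E)%E.
Proof.
move=> s0 x0; set A := [set _ | _].
have mA : measurable A by exact: measurable_dist_ge.
have s2 : 0 < 2 * s by rewrite mulr_gt0.
rewrite -[leLHS]mule1.
rewrite /normal_prob [leLHS](_ : _ =
  \int[lebesgue_measure]_(y in A) (gauss_pdf m s y)%:E)%E ?mule1//.
rewrite integral_mkcond.
apply: (@le_trans _ _ (\int[lebesgue_measure]_y
   ((Num.sqrt 2 * expR (- x ^+ 2 / (4 * s)))%:E * (gauss_pdf m (2 * s) y)%:E))%E).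
  apply: le_integral_ge0 => y.
    by rewrite patchE; case: ifP => _ //; rewrite lee_fin gauss_pdf_ge0.
  rewrite -EFinM patchE; case: ifPn => [/set_mem Ay|_]; last first.
    by rewrite lee_fin mulr_ge0 ?gauss_pdf_ge0// mulr_ge0 ?expR_ge0 ?sqrtr_ge0.
  rewrite lee_fin mulrAC.
  have := @gauss_pdf_tilt m s (2 * s) y s0 s2.
  rewrite mulfK ?gt_eqF// => <-.
  rewrite mulrAC -expRD ler_peMl ?gauss_pdf_ge0//.
  rewrite -[leLHS]expR0 ler_expR.
  have -> : - ((2 * s)^-1 - s^-1) / 2 * (y - m) ^+ 2 + - x ^+ 2 / (4 * s) =
    ((y - m) ^+ 2 - x ^+ 2) / (4 * s) by field; rewrite gt_eqF.
  apply: divr_ge0; last by rewrite mulr_ge0// ltW.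
  by rewrite subr_ge0 -(real_normK (num_real (y - m))) ler_pXn2r ?nnegrE.
rewrite ge0_integralZl//; last 2 first.
- by apply/measurable_EFinP; exact: measurable_gauss_pdf.
- by move=> y _; rewrite lee_fin gauss_pdf_ge0.
by rewrite integral_gauss_pdf ?mule1.
Qed.

Lemma gauss_pdf_ub m v x : 1 <= v -> gauss_pdf m v x <= normal_peak 1.
Proof.
move=> v1; have v0 : 0 < v by exact: lt_le_trans v1.
have p0 : 0 <= normal_peak (1 : R) by rewrite ltW// normal_peak_gt0// oner_neq0.
rewrite gauss_pdfE// -mulrA ler_piMr// mulr_ile1 ?expR_ge0 ?invr_ge0 ?sqrtr_ge0//.
  by rewrite invf_le1 ?sqrtr_gt0// -[leLHS]sqrtr1 ler_wsqrtr.
rewrite -[leRHS]expR0 ler_expR mulNr oppr_le0 divr_ge0 ?sqr_ge0//.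
by rewrite mulr_ge0// ltW.
Qed.

Lemma inv_sqrt1D_ge s : 0 <= s -> expR (- s / 2) <= (Num.sqrt (1 + s))^-1.
Proof.
move=> s0; have s1 : 0 < 1 + s by rewrite ltr_wpDr.
rewrite mulNr expRN lef_pV2 ?posrE ?expR_gt0 ?sqrtr_gt0//.
rewrite -(@ler_pXn2r _ 2)// ?nnegrE ?sqrtr_ge0 ?expR_ge0// sqr_sqrtr ?(ltW s1)//.
rewrite -expRM_natl (_ : 2%:R * (s / 2) = s) ?expR_ge1Dx//; by field.
Qed.

Lemma gauss_marginal_ge s y : 0 <= s ->
  expR (- s / 2) * gauss_pdf 0 1 y <= gauss_pdf 0 (1 + s) y.
Proof.
move=> s0; have s1 : 0 < 1 + s by rewrite ltr_wpDr.
have p0 : 0 <= normal_peak (1 : R) by rewrite ltW// normal_peak_gt0// oner_neq0.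
rewrite !gauss_pdfE// sqrtr1 invr1 mulr1 mulrCA -[leRHS]mulrA ler_wpM2l//.
apply: ler_pM; [exact: expR_ge0|exact: expR_ge0|exact: inv_sqrt1D_ge|].
rewrite ler_expR !mulNr lerN2 ler_wpM2l ?sqr_ge0// lef_pV2 ?posrE ?mulr_gt0//.
by rewrite ler_wpM2l// lerDl.
Qed.

(** Meant for the signal coordinate: keeping [y ^+ 2 / (2 * s)] instead of y^2 / 2 lets a larger
    scale pay for a distant [y]. *)
Lemma gauss_marginal_ge_far s y : 0 < s ->
  normal_peak 1 * expR (- s / 2 - y ^+ 2 / (2 * s)) <= gauss_pdf 0 (1 + s) y.
Proof.
move=> s0; have s1 : 0 < 1 + s by rewrite addr_gt0.
have p0 : 0 <= normal_peak (1 : R) by rewrite ltW// normal_peak_gt0// oner_neq0.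
rewrite gauss_pdfE// subr0 expRD -mulrA ler_wpM2l//.
apply: ler_pM; [exact: expR_ge0|exact: expR_ge0| |].
  exact: inv_sqrt1D_ge (ltW s0).
rewrite ler_expR mulNr lerN2 ler_wpM2l ?sqr_ge0// lef_pV2 ?posrE ?mulr_gt0//.
by rewrite ler_wpM2l// lerDr.
Qed.
End gaussian.

(** * The laws of the scales *)

Lemma integral_conull {d} {T : measurableType d} {R : realType}
    (mu : {measure set T -> \bar R}) (A : set T) (f : T -> \bar R) :
  measurable A -> mu (~` A) = 0%E -> measurable_fun setT f ->
  (forall x, 0 <= f x)%E -> (\int[mu]_x f x = \int[mu]_(x in A) f x)%E.
Proof.
move=> mA A0 mf f0; have mCA := measurableC mA.
rewrite -(setUCr A) ge0_integral_setU//.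
- by rewrite [X in (_ + X)%E]null_set_integral ?adde0//; exact: measurable_funTS.
- exact: measurable_funTS.
- exact/disj_setPCl.
Qed.

(** The form in which integrals are bounded below in the sequel: restrict to a set on which the
    integrand exceeds a constant. *)
Lemma cst_mul_le_integral {d} {T : measurableType d} {R : realType}
    (mu : {measure set T -> \bar R}) (A D : set T) (c : \bar R) (f : T -> \bar R) :
  measurable A -> measurable D -> A `<=` D -> measurable_fun D f ->
  (forall x, D x -> 0 <= f x)%E -> (0 <= c)%E -> (forall x, A x -> c <= f x)%E ->
  (c * mu A <= \int[mu]_(x in D) f x)%E.
Proof.
move=> mA mD AD mf f0 c0 cf; rewrite -integral_cst//.
apply: (@le_trans _ _ (\int[mu]_(x in A) f x)%E).
  by apply: ge0_le_integral => //; exact: measurable_funS mf.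
exact: ge0_subset_integral.
Qed.

Section exponential_law.
Context {R : realType} (lambda : R) (g : probability (measurableTypeR R) R).
Hypothesis lambda_gt0 : 0 < lambda.
Hypothesis g_exp : forall A : set (measurableTypeR R), measurable A ->
  g A = exponential_prob lambda A.

Lemma expo_set1 x : g [set x] = 0%E.
Proof. by rewrite g_exp// /exponential_prob integral_set1. Qed.

Lemma expo_lt0 : g (`]-oo, 0%R[%classic : set R) = 0%E.
Proof.
rewrite g_exp// /exponential_prob integral0_eq// => x.
by rewrite /= in_itv/= => x0; rewrite lt0_exponential_pdf.
Qed.

Lemma expo_Nyo0 : g (`]-oo, 0%R]%classic : set R) = 0%E.
Proof.
have -> : (`]-oo, 0%R]%classic : set R) = `]-oo, 0[ `|` [set 0].
  apply/seteqP; split => x /=; rewrite !in_itv/= le_eqVlt.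
    by case/orP => [/eqP|]; [right|left].
  by case=> [|/eqP] ->; rewrite ?orbT.
transitivity (g (`]-oo, 0%R[%classic : set R) + g [set 0%R])%E.
  apply: measureU => //; apply/seteqP; split => x //= -[].
  by rewrite in_itv/= => /[swap] ->; rewrite ltxx.
by rewrite expo_set1 expo_lt0 adde0.
Qed.

Lemma expo_0c b : 0 < b -> g (`]0%R, b]%classic : set R) = (1 - expR (- lambda * b))%:E.
Proof.
move=> b0; rewrite EFinB -exponential_prob_itv0c// -g_exp//.
have -> : (`[0, b]%classic : set R) = [set 0] `|` `]0, b].
  apply/seteqP; split => x /=; rewrite !in_itv/=.
    case/andP => x0 ->; move: x0; rewrite le_eqVlt => /orP[/eqP|] x0; first by left.
    by right; rewrite x0.
  by case=> [->|/andP[/ltW -> ->]//]; rewrite lexx ltW.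
transitivity (g [set 0%R] + g (`]0%R, b]%classic : set R))%E; last first.
  by apply/esym/measureU => //; apply/seteqP; split => x //= -[->]; rewrite in_itv/= ltxx.
by rewrite expo_set1 add0e.
Qed.

Lemma expo_boy b : 0 < b -> g (`]b, +oo[%classic : set R) = (expR (- lambda * b))%:E.
Proof.
move=> b0; rewrite -setCitvl probability_setC//.
have -> : (`]-oo, b]%classic : set R) = `]-oo, 0] `|` `]0, b].
  apply/seteqP; split => x /=; rewrite !in_itv/=.
    by move=> ->; case: leP => _; [left|right].
  by case=> [/le_trans|/andP[]//]; apply; rewrite ltW.
transitivity (1 - (g (`]-oo, 0%R]%classic : set R) + g (`]0%R, b]%classic : set R)))%E.
  congr (1 - _)%E; apply: measureU => //.
  apply/seteqP; split => x //=; rewrite !in_itv/= => -[x0 /andP[]].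
  by rewrite ltNge x0.
by rewrite expo_Nyo0 add0e expo_0c// -EFinB; congr EFin; ring.
Qed.

(** Memorylessness of the exponential law. It compares the masses of two adjacent intervals by a
    factor that stays bounded below as [b] tends to 0. *)
Lemma expo_b2b b : 0 < b ->
  g (`]b, (2 * b)%R]%classic : set R) =
  ((expR (- lambda * b))%:E * g (`]0%R, b]%classic : set R))%E.
Proof.
move=> b0; have b2 : 0 < 2 * b by rewrite mulr_gt0.
have e : (`]0%R, (2 * b)%R]%classic : set R) = `]0, b] `|` `]b, 2 * b].
  apply/seteqP; split => x /=; rewrite !in_itv/=.
    by move=> /andP[-> ->]; rewrite andbT; case: leP => _; [left|right].
  by case=> /andP[x0 xb]; apply/andP; split; lra.
have : g (`]0%R, (2 * b)%R]%classic : set R) =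
    (g (`]0%R, b]%classic : set R) + g (`]b, (2 * b)%R]%classic : set R))%E.
  rewrite e; apply: measureU => //; apply/seteqP; split => x //=.
  by rewrite !in_itv/= => -[/andP[_ xb] /andP[]]; rewrite ltNge xb.
have : g (`]b, (2 * b)%R]%classic : set R) \is a fin_num by exact: fin_num_measure.
move=> /fineK <-; rewrite !expo_0c// -EFinD -EFinM => -[h]; congr EFin.
have -> : fine (g (`]b, (2 * b)%R]%classic : set R)) =
    expR (- lambda * b) - expR (- lambda * (2 * b)) by lra.
rewrite (_ : - lambda * (2 * b) = - lambda * b + - lambda * b); last by ring.
by rewrite expRD; ring.
Qed.
End exponential_law.

(** * The marginal likelihood of one coordinate *)

(* Here psi * t is a variance: for psi * t <= 0 the inner law is a placeholder. *)
Definition coord_mass {R : realType} (g : probability (measurableTypeR R) R)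
    (w : R -> \bar R) (t : R) : \bar R :=
  (\int[g]_psi \int[normal_prob 0 (Num.sqrt (psi * t))]_th w th)%E.

Definition coord_evidence {R : realType} (g : probability (measurableTypeR R) R)
    (t y : R) : \bar R :=
  coord_mass g (fun th => (gauss_pdf th 1 y)%:E) t.

Section coordinate_mass.
Context {R : realType} (g : probability (measurableTypeR R) R).
Implicit Types (w : R -> \bar R) (t y : R).

Lemma measurable_integral_normal_scale w :
  measurable_fun setT w -> (forall x, 0 <= w x)%E ->
  measurable_fun [set: measurableTypeR R * measurableTypeR R]
    (fun z => \int[normal_prob 0 (Num.sqrt (z.2 * z.1))]_th w th)%E.
Proof.
move=> mw w0; apply: measurable_fun_integral_kernel => // U mU.
apply: (measurableT_comp (measurable_normal_prob_sd mU)).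
apply: (@measurableT_comp _ _ _ _ _ _ (@Num.sqrt R)) => //.
  by apply: continuous_measurable_fun => x; exact: sqrt_continuous.
by apply: measurable_funM.
Qed.

Lemma measurable_coord_mass w :
  measurable_fun setT w -> (forall x, 0 <= w x)%E ->
  measurable_fun [set: measurableTypeR R] (coord_mass g w).
Proof.
move=> mw w0.
have := @measurable_fun_fubini_tonelli_F _ _ (measurableTypeR R)
  (measurableTypeR R) R g _ (measurable_integral_normal_scale _ mw w0).
apply => z; exact: integral_ge0.
Qed.

Lemma measurable_integral_normal_scale1 w t :
  measurable_fun setT w -> (forall x, 0 <= w x)%E ->
  measurable_fun [set: measurableTypeR R]
    (fun psi => \int[normal_prob 0 (Num.sqrt (psi * t))]_th w th)%E.
Proof.
move=> mw w0.
exact: (measurableT_comp (measurable_integral_normal_scale _ mw w0)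
  (measurable_pair1 t)).
Qed.

Lemma coord_mass_ge0 w t : (forall x, 0 <= w x)%E -> (0 <= coord_mass g w t)%E.
Proof. by move=> w0; apply: integral_ge0 => psi _; exact: integral_ge0. Qed.

Lemma measurable_gauss_pdf_meanE y :
  measurable_fun [set: R] (fun th => (gauss_pdf th 1 y)%:E).
Proof. by apply/measurable_EFinP; apply: measurable_gauss_pdf_mean. Qed.

Lemma gauss_pdf_meanE_ge0 y th : (0 <= (gauss_pdf th 1 y)%:E)%E.
Proof. by rewrite lee_fin gauss_pdf_ge0. Qed.

Lemma measurable_gauss_pdf_scale t y : 0 < t ->
  measurable_fun (`]0%R, +oo[%classic : set R)
    (fun psi => (gauss_pdf 0 (1 + psi * t) y)%:E).
Proof.
move=> t0.
have := measurable_integral_normal_scale1 _ t (measurable_gauss_pdf_meanE y)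
  (gauss_pdf_meanE_ge0 y).
move=> /(measurable_funTS (D := (`]0%R, +oo[%classic : set R))).
apply: eq_measurable_fun => psi; rewrite inE/= in_itv/= andbT => psi0.
by rewrite gauss_marginal// mulr_gt0.
Qed.

Hypothesis g_pos : g (`]-oo, 0%R]%classic : set R) = 0%E.

Lemma coord_mass_pos w t : measurable_fun setT w -> (forall x, 0 <= w x)%E ->
  (coord_mass g w t = \int[g]_(psi in `]0%R, +oo[)
     \int[normal_prob 0 (Num.sqrt (psi * t))]_th w th)%E.
Proof.
move=> mw w0; apply: integral_conull => //.
- by rewrite setCitvr.
- exact: measurable_integral_normal_scale1.
- by move=> x; exact: integral_ge0.
Qed.

Lemma coord_evidenceE t y : 0 < t ->
  (coord_evidence g t y =
   \int[g]_(psi in `]0%R, +oo[) (gauss_pdf 0 (1 + psi * t) y)%:E)%E.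
Proof.
move=> t0; rewrite /coord_evidence coord_mass_pos.
- apply: eq_integral => psi; rewrite inE/= in_itv/= andbT => psi0.
  by rewrite gauss_marginal// mulr_gt0.
- exact: measurable_gauss_pdf_meanE.
- exact: gauss_pdf_meanE_ge0.
Qed.

Lemma coord_evidence_ub t y : 0 < t ->
  (coord_evidence g t y <= (normal_peak 1)%:E)%E.
Proof.
move=> t0; rewrite coord_evidenceE//.
have p0 : (0 : R) <= normal_peak 1 by rewrite ltW// normal_peak_gt0// oner_neq0.
apply: (@le_trans _ _ (\int[g]_(psi in `]0%R, +oo[) (normal_peak 1)%:E)%E).
  apply: ge0_le_integral => //=.
  - by move=> psi _; rewrite lee_fin gauss_pdf_ge0.
  - exact: measurable_gauss_pdf_scale.
  - move=> psi; rewrite in_itv/= andbT => psi0; rewrite lee_fin gauss_pdf_ub//.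
    by rewrite lerDl mulr_ge0 ?ltW.
rewrite integral_cst// -[leRHS]mule1 lee_wpmul2l ?lee_fin//.
exact: probability_le1.
Qed.

End coordinate_mass.

(** With k = exp(lambda + 3/2), this is the least c such that A + B / 2 <= c (A + B) whenever 0 <= A
    <= k B. *)
Definition shrink_rate {R : realType} (lambda : R) : R :=
  1 - (2 * (1 + expR (lambda + 3 / 2)))^-1.

Lemma shrink_rate_lt1 {R : realType} (lambda : R) : shrink_rate lambda < 1.
Proof.
by rewrite /shrink_rate ltrBlDr ltrDl invr_gt0 mulr_gt0// ltr_pwDl// expR_ge0.
Qed.

Lemma shrink_rate_gt0 {R : realType} (lambda : R) : 0 < shrink_rate lambda.
Proof.
rewrite /shrink_rate subr_gt0 invf_lt1; have := expR_gt0 (lambda + 3 / 2); lra.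
Qed.

Lemma gauss_marginal_weighted_le {R : realType} (c s u y : R) :
  0 < s -> 0 <= u -> 0 <= c -> 1 + s <= c ^+ 2 * (1 + s + 2 * u * s) ->
  (\int[normal_prob 0 (Num.sqrt s)]_x (expR (- u * x ^+ 2) * gauss_pdf x 1 y)%:E <=
   (c * gauss_pdf 0 (1 + s) y)%:E)%E.
Proof.
move=> s0 u0 c0 h; apply: le_trans (gauss_marginal_weighted _ _ _ s0 u0) _.
have us : 0 < 1 + s + 2 * u * s.
  by rewrite ltr_pwDl ?addr_gt0// !mulr_ge0// ltW.
rewrite lee_fin ler_wpM2r ?gauss_pdf_ge0// -[leRHS]ger0_norm// -sqrtr_sqr.
by rewrite ler_wsqrtr// ler_pdivrMr.
Qed.

Lemma gauss_marginal_weighted_le1 {R : realType} (s u y : R) :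
  0 < s -> 0 <= u ->
  (\int[normal_prob 0 (Num.sqrt s)]_x (expR (- u * x ^+ 2) * gauss_pdf x 1 y)%:E <=
   (gauss_pdf 0 (1 + s) y)%:E)%E.
Proof.
move=> s0 u0; have us0 : 0 <= u * s by rewrite mulr_ge0// ltW.
rewrite -[X in (_ <= X%:E)%E]mul1r; apply: gauss_marginal_weighted_le => //.
by rewrite expr1n; lra.
Qed.

Lemma measurable_weighted_pdf {R : realType} (u y : R) :
  measurable_fun [set: R] (fun th => (expR (- u * th ^+ 2) * gauss_pdf th 1 y)%:E).
Proof.
apply/measurable_EFinP; apply: measurable_funM.
  by apply: measurableT_comp => //; exact: measurable_funM.
by apply: measurable_gauss_pdf_mean.
Qed.

Lemma weighted_pdf_ge0 {R : realType} (u y th : R) :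
  (0 <= (expR (- u * th ^+ 2) * gauss_pdf th 1 y)%:E)%E.
Proof. by rewrite lee_fin mulr_ge0 ?expR_ge0 ?gauss_pdf_ge0. Qed.

Section contraction.
Context {R : realType} (lambda : R) (g : probability (measurableTypeR R) R).
Hypothesis lambda_gt0 : 0 < lambda.
Hypothesis g_exp : forall A : set (measurableTypeR R), measurable A ->
  g A = exponential_prob lambda A.
Implicit Types t u y : R.

Let g_pos : g (`]-oo, 0%R]%classic : set R) = 0%E.
Proof. exact: expo_Nyo0 g_exp. Qed.

Lemma coord_mass_weighted_le u t y : 0 < t -> 0 <= u ->
  (coord_mass g (fun th => (expR (- u * th ^+ 2) * gauss_pdf th 1 y)%:E) t <=
   coord_evidence g t y)%E.
Proof.
move=> t0 u0; rewrite coord_evidenceE// coord_mass_pos//; last 2 first.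
- exact: measurable_weighted_pdf.
- exact: weighted_pdf_ge0.
apply: ge0_le_integral => //=.
- by move=> psi _; apply: integral_ge0 => th _; exact: weighted_pdf_ge0.
- apply: measurable_funTS.
  apply: measurable_integral_normal_scale1; first exact: measurable_weighted_pdf.
  exact: weighted_pdf_ge0.
- exact: measurable_gauss_pdf_scale.
move=> psi; rewrite in_itv/= andbT => psi0.
by apply: gauss_marginal_weighted_le1 => //; exact: mulr_gt0.
Qed.

Lemma gauss_pdf01_ge y : `|y| <= 1 ->
  normal_peak 1 * expR (- 1 / 2) <= gauss_pdf 0 1 y.
Proof.
move=> y1; rewrite gauss_pdfE// sqrtr1 invr1 mulr1 ler_wpM2l ?normal_peak_ge0//.
rewrite ler_expR subr0 mulr1 !mulNr lerN2 ler_wpM2r//.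
by rewrite -(real_normK (num_real y)) expr_le1.
Qed.

(* Let b = min(t,1) / t. For psi > b the weight at least halves the marginal
   density. The mass of psi <= b is at most a constant times that of
   ]b, 2b], because |y| <= 1 and psi * t <= 2 there keep the marginal density
   between two positive constants. *)
Lemma coord_mass_contraction t y : 0 < t -> `|y| <= 1 ->
  (coord_mass g
     (fun th => (expR (- (3 / Num.min t 1) * th ^+ 2) * gauss_pdf th 1 y)%:E) t <=
   (shrink_rate lambda)%:E * coord_evidence g t y)%E.
Proof.
move=> t0 y1.
pose d := Num.min t 1; have d0 : 0 < d by rewrite lt_min t0 ltr01.
have d1 : d <= 1 by rewrite ge_min lexx orbT.
have dt : d <= t by rewrite ge_min lexx.
pose b := d / t; have b0 : 0 < b by rewrite divr_gt0.
have b1 : b <= 1 by rewrite ler_pdivrMr ?mul1r.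
have bt : b * t = d by rewrite divfK// gt_eqF.
have u0 : 0 <= 3 / d by rewrite divr_ge0// ltW.
have U : (`]0%R, +oo[%classic : set R) = `]0%R, b]%classic `|` `]b, +oo[%classic.
  apply/seteqP; split => x /=; rewrite !in_itv/= !andbT.
    by move=> ->; case: leP; [left|right].
  by case=> [/andP[]//|]; exact: lt_trans.
have dis : [disjoint (`]0%R, b]%classic : set R) & `]b, +oo[%classic]%classic.
  apply/disj_setPS => x /= []; rewrite !in_itv/= => /andP[_ xb].
  by rewrite andbT ltNge xb.
pose G psi := (gauss_pdf 0 (1 + psi * t) y)%:E.
have mG : measurable_fun (`]0%R, +oo[%classic : set R) G.
  exact: measurable_gauss_pdf_scale.
have G0 psi : (0 <= G psi)%E by rewrite lee_fin gauss_pdf_ge0.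
pose W psi := (\int[normal_prob 0 (Num.sqrt (psi * t))]_th
  (expR (- (3 / d) * th ^+ 2) * gauss_pdf th 1 y)%:E)%E.
have W0 psi : (0 <= W psi)%E.
  by apply: integral_ge0 => th _; exact: weighted_pdf_ge0.
have mW : measurable_fun setT W.
  apply: measurable_integral_normal_scale1; first exact: measurable_weighted_pdf.
  exact: weighted_pdf_ge0.
have mG1 : measurable_fun (`]0%R, b]%classic : set R) G.
  by apply: measurable_funS mG => // x; rewrite U; left.
have mG2 : measurable_fun (`]b, +oo[%classic : set R) G.
  by apply: measurable_funS mG => // x; rewrite U; right.
pose A := (\int[g]_(psi in `]0%R, b]) G psi)%E.
pose B := (\int[g]_(psi in `]b, +oo[) G psi)%E.
have EE : coord_evidence g t y = (A + B)%E.
  rewrite coord_evidenceE// U ge0_integral_setU//; first by rewrite -U.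
  by move=> psi _; exact: G0.
have A0 : (0 <= A)%E by exact: integral_ge0.
have B0 : (0 <= B)%E by exact: integral_ge0.
have EF : (A + B < +oo)%E.
  rewrite -EE; apply: le_lt_trans (coord_evidence_ub _ g_pos _ _ t0) _.
  exact: ltry.
have Afin : A \is a fin_num.
  by rewrite ge0_fin_numE//; apply: le_lt_trans EF; rewrite leeDl.
have Bfin : B \is a fin_num.
  by rewrite ge0_fin_numE//; apply: le_lt_trans EF; rewrite leeDr.
have N1 : (coord_mass g (fun th => (expR (- (3 / d) * th ^+ 2) *
    gauss_pdf th 1 y)%:E) t <= A + (2^-1)%:E * B)%E.
  rewrite coord_mass_pos//; last 2 first.
  - exact: measurable_weighted_pdf.
  - exact: weighted_pdf_ge0.
  rewrite -/W U ge0_integral_setU//;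
    [|exact: measurable_funTS mW|by move=> psi _; exact: W0].
  rewrite leeD//.
    apply: ge0_le_integral => //; first by move=> psi _; exact: W0.
      exact: measurable_funTS mW.
    move=> psi /=; rewrite in_itv/= => /andP[psi0 _].
    by apply: gauss_marginal_weighted_le1 => //; exact: mulr_gt0.
  rewrite /B -ge0_integralZl//.
  apply: ge0_le_integral => //.
  - by move=> psi _; exact: W0.
  - exact: measurable_funTS mW.
  - by apply: emeasurable_funM.
  move=> psi /=; rewrite in_itv/= andbT => psib.
  have psi0 : 0 < psi by exact: lt_trans psib.
  rewrite /G -EFinM; apply: gauss_marginal_weighted_le; rewrite ?mulr_gt0//.
  have ds : d <= psi * t by rewrite -bt ler_pM2r// ltW.
  (* Origin of the 3 in the weight: halving requires 3 (1 + s) <= 2 u s for [s = psi * t >= d]. As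
     [d <= 1], s / d is at least 1 and at least s, so u = 3 / d suffices. *)
  have : 3 * (1 + psi * t) <= 2 * (3 / d) * (psi * t).
    rewrite -mulrA [X in _ <= 2 * X]mulrAC [X in _ <= X]mulrA ler_pdivlMr//.
    have : d * (psi * t) <= psi * t by rewrite ler_piMl// ltW// mulr_gt0.
    lra.
  lra.
(* The exponent collects [lambda * b <= lambda] from memorylessness, 1 from [psi * t <= 2] on []b,
   2b]], and 1/2 from [|y| <= 1]. *)
have AB : (A <= (expR (lambda + 3 / 2))%:E * B)%E.
  have Aub : (A <= (normal_peak 1)%:E * g (`]0%R, b]%classic : set R))%E.
    rewrite -integral_cst//; apply: ge0_le_integral => //.
    move=> psi /=; rewrite in_itv/= => /andP[psi0 _].
    by rewrite lee_fin gauss_pdf_ub// lerDl mulr_ge0 ?ltW.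
  have Blb : ((normal_peak 1 * expR (- (3 / 2)))%:E *
      g (`]b, (2 * b)%R]%classic : set R) <= B)%E.
    apply: cst_mul_le_integral => //.
    - by move=> x /=; rewrite !in_itv/= => /andP[->].
    - by rewrite lee_fin mulr_ge0 ?expR_ge0 ?normal_peak_ge0.
    move=> psi /=; rewrite in_itv/= => /andP[psib psi2b]; rewrite lee_fin.
    have psi0 : 0 < psi by exact: lt_trans psib.
    have s0 : 0 <= psi * t by rewrite mulr_ge0 ?ltW.
    have s2 : psi * t <= 2.
      apply: (@le_trans _ _ (2 * b * t)); first by rewrite ler_pM2r.
      by rewrite -mulrA bt; lra.
    apply: le_trans (gauss_marginal_ge _ y s0).
    have : expR (- (3 / 2)) <= expR (- (psi * t) / 2) * expR (- 1 / 2).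
      by rewrite -expRD ler_expR; lra.
    move=> /(ler_wpM2l (normal_peak_ge0 (1 : R))) /le_trans; apply.
    by rewrite mulrCA ler_wpM2l ?expR_ge0// gauss_pdf01_ge.
  apply: (le_trans Aub).
  apply: le_trans (lee_wpmul2l _ Blb); last by rewrite lee_fin expR_ge0.
  rewrite (expo_b2b _ _ g_exp)// !muleA lee_wpmul2r//.
  rewrite -!EFinM lee_fin mulrCA -mulrA ler_peMr ?normal_peak_ge0//.
  rewrite -!expRD -[leLHS]expR0 ler_expR.
  have : lambda * b <= lambda by rewrite ler_piMr// ltW.
  lra.
rewrite EE; apply: (le_trans N1).
move: AB; rewrite -(fineK Afin) -(fineK Bfin) -5?(EFinD, EFinM) !lee_fin.
rewrite /shrink_rate; set k := expR _; set a := fine A; set c := fine B => ak.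
have k0 : 0 < k by exact: expR_gt0.
rewrite mulrBl mul1r lerBrDr -lerBrDl.
have -> : a + c - (a + 2^-1 * c) = 2^-1 * c by lra.
rewrite ler_pdivrMl ?mulr_gt0 ?addr_gt0//; lra.
Qed.
End contraction.

(** * Integrals against the prior *)

Section evidence_lower_bounds.
Context {R : realType} (lambda : R) (g : probability (measurableTypeR R) R).
Hypothesis lambda_gt0 : 0 < lambda.
Hypothesis g_exp : forall A : set (measurableTypeR R), measurable A ->
  g A = exponential_prob lambda A.
Implicit Types t y : R.

Let g_pos : g (`]-oo, 0%R]%classic : set R) = 0%E.
Proof. exact: expo_Nyo0 g_exp. Qed.

Lemma coord_evidence_ge_small a t y : 0 < t -> 0 < a ->
  (((1 - expR (- lambda * a)) * (expR (- (a * t) / 2) * gauss_pdf 0 1 y))%:E <=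
   coord_evidence g t y)%E.
Proof.
move=> t0 a0; rewrite coord_evidenceE// mulrC EFinM -(expo_0c _ _ g_exp)//.
apply: cst_mul_le_integral => //.
- by move=> x /=; rewrite !in_itv/= => /andP[->].
- exact: measurable_gauss_pdf_scale.
- by move=> psi _; rewrite lee_fin gauss_pdf_ge0.
- by rewrite lee_fin mulr_ge0 ?expR_ge0 ?gauss_pdf_ge0.
move=> psi /=; rewrite in_itv/= => /andP[psi0 psia]; rewrite lee_fin.
have s0 : 0 <= psi * t by apply: mulr_ge0; exact: ltW.
apply: le_trans (gauss_marginal_ge _ y s0).
rewrite ler_wpM2r ?gauss_pdf_ge0// ler_expR.
have : psi * t <= a * t by rewrite ler_pM2r.
lra.
Qed.

(** Keeps only psi in []H, 2H]], of mass given by [expo_b2b]. With t between [t0] and [2 * t0] the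
    variance lies between [H * t0] and 4 H t0, whose half is the [2 * H * t0] of the exponent. *)
Lemma coord_evidence_ge_large H t0 t y : 0 < H -> 0 < t0 -> t0 <= t <= 2 * t0 ->
  ((expR (- lambda * H) * (1 - expR (- lambda * H)) *
    (normal_peak 1 * expR (- 2 * H * t0 - y ^+ 2 / (2 * (H * t0)))))%:E <=
   coord_evidence g t y)%E.
Proof.
move=> H0 t00 /andP[t0t t2t]; have t0' : 0 < t by exact: lt_le_trans t0t.
rewrite coord_evidenceE// mulrC EFinM [X in (_ * X)%E]EFinM -(expo_0c _ _ g_exp)//.
rewrite -(expo_b2b _ _ g_exp)//.
apply: cst_mul_le_integral => //.
- by move=> x /=; rewrite !in_itv/= => /andP[/(lt_trans H0) ->].
- exact: measurable_gauss_pdf_scale.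
- by move=> psi _; rewrite lee_fin gauss_pdf_ge0.
- by rewrite lee_fin mulr_ge0 ?expR_ge0 ?normal_peak_ge0.
move=> psi /=; rewrite in_itv/= => /andP[Hpsi psi2H]; rewrite lee_fin.
have psi0 : 0 < psi by exact: lt_trans Hpsi.
have s0 : 0 < psi * t by exact: mulr_gt0.
apply: le_trans (gauss_marginal_ge_far _ y s0).
rewrite ler_wpM2l ?normal_peak_ge0// ler_expR lerB//.
  have : psi * t <= 2 * H * (2 * t0) by apply: ler_pM => //; exact: ltW.
  lra.
rewrite ler_wpM2l ?sqr_ge0// lef_pV2 ?posrE ?mulr_gt0//.
by rewrite ler_wpM2l//; apply: ler_pM => //; exact: ltW.
Qed.
End evidence_lower_bounds.

Section global_scale_law.
Context {R : realType} (f : R -> R) (P : probability (measurableTypeR R) R).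
Hypothesis P_density : forall A : set (measurableTypeR R), measurable A ->
  P A = (\int[lebesgue_measure]_(t in A `&` `]0%R, +oo[) (f t)%:E)%E.

Lemma density_Nyo0 : P (`]-oo, 0%R]%classic : set R) = 0%E.
Proof.
rewrite P_density// (_ : _ `&` _ = set0) ?integral_set0//.
apply/seteqP; split => x //= -[]; rewrite !in_itv/= andbT => x0.
by rewrite ltNge x0.
Qed.

Lemma density_itv_ge (c t : R) : measurable_fun (`]0%R, +oo[%classic : set R) f ->
  (forall x, 0 < x -> 0 <= f x) -> 0 <= c -> (forall x, 0 < x < 1 -> c <= f x) ->
  0 < t -> 2 * t < 1 -> ((c * t)%:E <= P (`]t, (2 * t)%R]%classic : set R))%E.
Proof.
move=> mf f0 c0 cf t0 t1; rewrite P_density//.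
have -> : (`]t, (2 * t)%R]%classic : set R) `&` `]0%R, +oo[ = `]t, (2 * t)%R]%classic.
  apply/seteqP; split => x /=; rewrite !in_itv/= andbT; first by case.
  by move=> /andP[tx ->]; rewrite tx (lt_trans t0).
have -> : ((c * t)%:E = c%:E * lebesgue_measure (`]t, (2 * t)%R]%classic : set R))%E.
  rewrite lebesgue_measure_itv/= lte_fin ifT; last by lra.
  by rewrite -EFinB -EFinM; congr EFin; ring.
apply: cst_mul_le_integral => //.
- apply/measurable_EFinP; apply: measurable_funS mf => // x /=.
  by rewrite !in_itv/= andbT => /andP[/(lt_trans t0)].
- move=> x /=; rewrite in_itv/= => /andP[/(lt_trans t0) x0 _].
  by rewrite lee_fin f0.
move=> x /=; rewrite in_itv/= => /andP[/(lt_trans t0) x0 xt].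
by rewrite lee_fin cf// x0/= (le_lt_trans xt).
Qed.
End global_scale_law.

Section prior_integrals.
Context {R : realType} (P g : probability (measurableTypeR R) R) (n : nat).
Implicit Types F : vec R n -> \bar R.

(** The values of [gl_kernel] bundled as probabilities, for use in [integral_mixture] and in
    Tonelli's theorem. *)
Definition conditional_law (z : measurableTypeR R * vec R n) :
    probability (vec R n) R :=
  prod_prob (fun j : 'I_n => normal_prob 0 (Num.sqrt (tnth z.2 j * z.1))).

Definition conditional_mass F z : \bar R := (\int[conditional_law z]_th F th)%E.

Lemma conditional_mass_ge0 F z :
  (forall th, 0 <= F th)%E -> (0 <= conditional_mass F z)%E.
Proof. by move=> F0; exact: integral_ge0. Qed.

Lemma measurable_conditional_mass F :
  measurable_fun setT F -> (forall th, 0 <= F th)%E ->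
  measurable_fun setT (conditional_mass F).
Proof.
move=> mF F0; apply: (@measurable_fun_integral_kernel _ _ _ _ _
  (fun z => gl_kernel z)) => // U mU.
exact: measurable_gl_kernel.
Qed.

Lemma integral_gl_prior F : measurable_fun setT F -> (forall th, 0 <= F th)%E ->
  (\int[gl_prior P g n]_th F th =
   \int[P]_t \int[prod_prob (fun _ : 'I_n => g)]_psi conditional_mass F (t, psi))%E.
Proof.
move=> mF F0; rewrite /gl_prior (integral_mixture _ _ conditional_law)//.
rewrite fubini_tonelli1//; first exact: measurable_conditional_mass.
by move=> z; exact: conditional_mass_ge0.
Qed.

Lemma measurable_scale_mass F :
  measurable_fun setT F -> (forall th, 0 <= F th)%E ->
  measurable_fun [set: measurableTypeR R]
    (fun t => \int[prod_prob (fun _ : 'I_n => g)]_psi conditional_mass F (t, psi))%E.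
Proof.
move=> mF F0.
have := @measurable_fun_fubini_tonelli_F _ _ (measurableTypeR R)
  (vec R n) R (prod_prob (fun _ : 'I_n => g)) _ (measurable_conditional_mass _ mF F0).
by apply => z; exact: conditional_mass_ge0.
Qed.

(** Given the global scale, the pairs (psi_j, theta_j) are independent, so the integrals over psi
    and over theta both factor. *)
Lemma scale_mass_prod (w : 'I_n -> R -> \bar R) t :
  (forall j, measurable_fun setT (w j)) -> (forall j x, 0 <= w j x)%E ->
  (\int[prod_prob (fun _ : 'I_n => g)]_psi
     conditional_mass (fun th => \prod_(j < n) w j (tnth th j)) (t, psi) =
   \prod_(j < n) coord_mass g (w j) t)%E.
Proof.
move=> mw w0; rewrite /conditional_mass /conditional_law.
under eq_integral do rewrite integral_prod_prob//=.
rewrite (integral_prod_prob _ (fun=> g)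
  (fun j psi => \int[normal_prob 0 (Num.sqrt (psi * t))]_x w j x)%E)//.
- by move=> j; exact: measurable_integral_normal_scale1.
- by move=> j x; exact: integral_ge0.
Qed.

Hypothesis P_pos : P (`]-oo, 0%R]%classic : set R) = 0%E.

Lemma integral_gl_prior_pos F : measurable_fun setT F -> (forall th, 0 <= F th)%E ->
  (\int[gl_prior P g n]_th F th =
   \int[P]_(t in `]0%R, +oo[)
     \int[prod_prob (fun _ : 'I_n => g)]_psi conditional_mass F (t, psi))%E.
Proof.
move=> mF F0; rewrite integral_gl_prior//; apply: integral_conull => //.
- by rewrite setCitvr.
- exact: measurable_scale_mass.
- by move=> t; apply: integral_ge0 => psi _; exact: conditional_mass_ge0.
Qed.
End prior_integrals.

Lemma lee_prode {R : realDomainType} n (a b : 'I_n -> \bar R) :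
  (forall i, 0 <= a i)%E -> (forall i, a i <= b i)%E ->
  (\prod_(i < n) a i <= \prod_(i < n) b i)%E.
Proof.
elim: n a b => [|n IH] a b a0 ab; first by rewrite !big_ord0.
by rewrite !big_ord_recl lee_pmul ?prode_ge0// IH.
Qed.

(** * The numerator of the posterior *)

Section bayes_numerator.
Context {R : realType} (P g : probability (measurableTypeR R) R) (n : nat).
Hypothesis P_pos : P (`]-oo, 0%R]%classic : set R) = 0%E.
Implicit Types (y th : vec R n) (A : set (vec R n)).

Lemma likelihoodE y th :
  (likelihood y th)%:E = (\prod_(j < n) (gauss_pdf (tnth th j) 1 (tnth y j))%:E)%E.
Proof.
by rewrite prodEFin; congr EFin; apply: eq_bigr => j _; rewrite /gauss_pdf sqrtr1.
Qed.

Lemma measurable_indic_likelihood A y : measurable A ->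
  measurable_fun setT (fun th => (\1_A th * likelihood y th)%:E).
Proof.
move=> mA; apply/measurable_EFinP; apply: measurable_funM => //.
exact: measurable_likelihood.
Qed.

Lemma indic_likelihood_ge0 A y th : (0 <= (\1_A th * likelihood y th)%:E)%E.
Proof. by rewrite lee_fin mulr_ge0// likelihood_ge0. Qed.

Definition scale_mass (F : vec R n -> \bar R) (t : R) : \bar R :=
  (\int[prod_prob (fun _ : 'I_n => g)]_psi conditional_mass n F (t, psi))%E.

Lemma scale_mass_ge0 F t : (forall th, 0 <= F th)%E -> (0 <= scale_mass F t)%E.
Proof. by move=> F0; apply: integral_ge0 => psi _; exact: conditional_mass_ge0. Qed.

Lemma scale_mass_le F1 F2 t : (forall th, 0 <= F1 th)%E ->
  (forall th, F1 th <= F2 th)%E -> (scale_mass F1 t <= scale_mass F2 t)%E.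
Proof.
move=> F10 F12; apply: le_integral_ge0 => psi; first exact: conditional_mass_ge0.
exact: le_integral_ge0.
Qed.

Lemma scale_massZ F (c : R) t : 0 <= c -> measurable_fun setT F ->
  (forall th, 0 <= F th)%E ->
  (scale_mass (fun th => c%:E * F th) t = c%:E * scale_mass F t)%E.
Proof.
move=> c0 mF F0; rewrite /scale_mass -ge0_integralZl//.
- by apply: eq_integral => psi _; rewrite /conditional_mass ge0_integralZl.
- exact: (measurableT_comp (measurable_conditional_mass _ _ mF F0)
    (measurable_pair1 t)).
- by move=> psi _; exact: conditional_mass_ge0.
Qed.

Lemma bayes_massE A y : measurable A ->
  (bayes_mass (gl_prior P g n) y A =
   \int[P]_(t in `]0%R, +oo[) scale_mass (fun th => (\1_A th * likelihood y th)%:E) t)%E.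
Proof.
move=> mA; rewrite /bayes_mass integral_mkcond -(integral_gl_prior_pos _ _ _ P_pos).
- apply: eq_integral => th _; rewrite patchE indicE.
  by case: ifP => _; rewrite ?mul1r ?mul0r.
- exact: measurable_indic_likelihood.
- exact: indic_likelihood_ge0.
Qed.

Definition total_evidence y (t : R) : \bar R :=
  (\prod_(j < n) coord_evidence g t (tnth y j))%E.

Lemma total_evidence_ge0 y t : (0 <= total_evidence y t)%E.
Proof.
by apply: prode_ge0 => j _; apply: coord_mass_ge0 => x; exact: gauss_pdf_meanE_ge0.
Qed.

Lemma measurable_total_evidence y :
  measurable_fun [set: measurableTypeR R] (total_evidence y).
Proof.
apply: (@measurable_prode _ _ _ _ _ (fun j t => coord_evidence g t (tnth y j))) => j.
apply: measurable_coord_mass; first exact: measurable_gauss_pdf_meanE.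
exact: gauss_pdf_meanE_ge0.
Qed.

Lemma bayes_evidenceE y :
  (bayes_mass (gl_prior P g n) y setT =
   \int[P]_(t in `]0%R, +oo[) total_evidence y t)%E.
Proof.
rewrite bayes_massE//; apply: eq_integral => t _.
rewrite /total_evidence /coord_evidence -scale_mass_prod; last 2 first.
- by move=> j; exact: measurable_gauss_pdf_meanE.
- by move=> j x; exact: gauss_pdf_meanE_ge0.
rewrite /scale_mass; congr (integral _ _ _); apply/funext => psi.
congr (conditional_mass _ _); apply/funext => th.
by rewrite indicT mul1r likelihoodE.
Qed.
End bayes_numerator.

(** * Large global scales: shrinkage of the null coordinates *)

Section noise_shrinkage.
Context {R : realType} (lambda : R) (g : probability (measurableTypeR R) R).
Hypothesis lambda_gt0 : 0 < lambda.
Hypothesis g_exp : forall A : set (measurableTypeR R), measurable A ->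
  g A = exponential_prob lambda A.
Context (n : nat) (k : 'I_n).
Implicit Types (y th : vec R n) (A : set (vec R n)).

(** Equal to 1 where no gain is claimed: at the coordinate [k], which the ball does not force to be
    small, and at observations outside the range of [coord_mass_contraction]. *)
Definition noise_factor (j : 'I_n) (x : R) : R :=
  if (j != k) && (`|x| <= 1) then shrink_rate lambda else 1.

Lemma noise_factor_ge0 j x : 0 <= noise_factor j x.
Proof. by rewrite /noise_factor; case: ifP => // _; rewrite ltW// shrink_rate_gt0. Qed.

(* Bounds the indicator of the ball by exp(u (l - \sum_(j != k) th_j^2)) with
   u = 3 / min(t,1), after which the coordinates separate. *)
Lemma scale_mass_noise (l t1 t : R) A y :
  0 <= l -> 0 < t1 -> t1 <= 1 -> t1 <= t ->
  (forall th, A th -> \sum_(j < n | j != k) tnth th j ^+ 2 <= l) ->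
  (scale_mass g n (fun th => (\1_A th * likelihood y th)%:E) t <=
   (expR (3 * l / t1) * \prod_(j < n) noise_factor j (tnth y j))%:E *
   total_evidence g n y t)%E.
Proof.
move=> l0 t10 t11 t1t Al; have t0 : 0 < t by exact: lt_le_trans t1t.
pose u := 3 / Num.min t 1.
have m0 : 0 < Num.min t 1 by rewrite lt_min t0 ltr01.
have u0 : 0 <= u by rewrite divr_ge0// ltW.
(* Both [t1 <= t] and [t1 <= 1] enter, because of the cap at 1 in [u]. The price of the exponential
   weight is thus uniform over all t above [t1]. *)
have ut1 : u * l <= 3 * l / t1.
  rewrite /u mulrAC ler_wpM2l// ?mulr_ge0// lef_pV2 ?posrE//.
  by rewrite le_min t1t.
pose w j x : \bar R :=
  (expR (- (if j == k then 0 else u) * x ^+ 2) * gauss_pdf x 1 (tnth y j))%:E.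
have mw j : measurable_fun setT (w j) by exact: measurable_weighted_pdf.
have w0 j x : (0 <= w j x)%E by exact: weighted_pdf_ge0.
apply: (@le_trans _ _ (scale_mass g n
  (fun th => (expR (u * l))%:E * \prod_(j < n) w j (tnth th j))%E t)).
  apply: scale_mass_le => th; first exact: indic_likelihood_ge0.
  rewrite indicE; have [/set_mem/Al thA|_] := boolP (th \in A); last first.
    by rewrite mul0r mule_ge0 ?lee_fin ?expR_ge0//; exact: prode_ge0.
  have -> : (\prod_(j < n) w j (tnth th j) =
      (\prod_(j < n) expR (- (if j == k then 0 else u) * tnth th j ^+ 2))%:E *
      (likelihood y th)%:E)%E.
    by rewrite likelihoodE -prodEFin -big_split.
  rewrite mul1r muleA.
  rewrite -[leLHS]mul1e lee_wpmul2r//.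
    by rewrite lee_fin likelihood_ge0.
  rewrite -EFinM lee_fin -(big_morph _ (@expRD R) (@expR0 R)) -expRD.
  rewrite -[leLHS]expR0 ler_expR.
  rewrite (bigD1 k)//= eqxx oppr0 mul0r add0r.
  rewrite (eq_bigr (fun j => - u * tnth th j ^+ 2)); last first.
    by move=> j /negbTE ->.
  by rewrite -mulr_sumr mulNr -mulrBr mulr_ge0// subr_ge0.
rewrite scale_massZ ?expR_ge0//; last 2 first.
- exact: measurable_prod_tnth.
- by move=> th; exact: prode_ge0.
rewrite EFinM -muleA; apply: lee_pmul.
- by rewrite lee_fin expR_ge0.
- by apply: scale_mass_ge0 => th; exact: prode_ge0.
- by rewrite lee_fin ler_expR.
rewrite /scale_mass scale_mass_prod// /total_evidence -prodEFin -big_split/=.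
apply: lee_prode => j; first by apply: coord_mass_ge0 => x; exact: w0.
rewrite /noise_factor /w; have [jk|jk] := eqVneq j k.
  by rewrite mul1e; apply: (coord_mass_weighted_le lambda).
have [yj|yj] := leP `|tnth y j| 1; last first.
  by rewrite mul1e; apply: (coord_mass_weighted_le lambda).
exact: (coord_mass_contraction lambda).
Qed.
End noise_shrinkage.

Lemma prod_prob_coord {d} {T : measurableType d} {R : realType} n
    (P : 'I_n -> probability T R) (k : 'I_n) (S : set T) : measurable S ->
  prod_prob P [set x | S (tnth x k)] = P k S.
Proof.
move=> mS.
rewrite (_ : [set x | _] =
    [set x | forall i, (if i == k then S else setT) (tnth x i)]); last first.
  apply/seteqP; split => x /=; last by move=> /(_ k); rewrite eqxx.
  by move=> Sx i; case: eqP => [->|].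
rewrite (@prod_probE _ _ _ _ P (fun i => if i == k then S else setT)); last first.
  by move=> i; case: ifP.
rewrite (bigD1 k)//= eqxx big1 ?mule1// => i /negbTE ->.
exact: probability_setT.
Qed.

(** * Geometry and posterior mass of the ball *)

Section ball.
Context {R : realType} (n : nat).
Implicit Types th : vec R n.

Lemma measurable_norm2_subt (th0 : vec R n) :
  measurable_fun setT (fun th : vec R n => norm2 (subt th th0)).
Proof.
apply: (measurableT_comp (f := @Num.sqrt R)).
  by apply: continuous_measurable_fun => x; exact: sqrt_continuous.
apply: measurable_sum => i; under eq_fun do rewrite tnth_mktuple.
apply: measurable_funX; apply: measurable_funB => //.
exact: measurable_tnth.
Qed.

Lemma measurable_ball2 (th0 : vec R n) (r : R) :
  measurable [set th : vec R n | norm2 (subt th th0) <= r].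
Proof.
rewrite -[X in measurable X]setTI.
have -> : [set th : vec R n | norm2 (subt th th0) <= r] =
    (fun th => norm2 (subt th th0)) @^-1` `]-oo, r]%classic.
  by apply/seteqP; split => th /=; rewrite in_itv.
exact: measurable_norm2_subt.
Qed.

Lemma sum_le_of_norm2 (th0 : vec R n) th (l : R) : 0 <= l ->
  norm2 (subt th th0) <= Num.sqrt l ->
  \sum_(j < n) (tnth th j - tnth th0 j) ^+ 2 <= l.
Proof.
move=> l0; rewrite /norm2 ler_sqrt//; apply: le_trans.
by apply: ler_sum => j _; rewrite tnth_mktuple.
Qed.

Lemma norm2_noise_le (th0 : vec R n) th (k : 'I_n) (l : R) : 0 <= l ->
  (forall j, j != k -> tnth th0 j = 0) ->
  norm2 (subt th th0) <= Num.sqrt l -> \sum_(j < n | j != k) tnth th j ^+ 2 <= l.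
Proof.
move=> l0 th0k /sum_le_of_norm2; move=> /(_ l0); rewrite (bigD1 k)//=.
apply: le_trans; rewrite -[leLHS]add0r lerD ?sqr_ge0//.
by apply: ler_sum => j jk; rewrite th0k// subr0.
Qed.

(** The hypothesis on [l] says that the radius of the ball is at most half the signal. *)
Lemma norm2_signal_ge (th0 : vec R n) th (k : 'I_n) (l : R) : 0 <= l ->
  4 * l <= tnth th0 k ^+ 2 ->
  norm2 (subt th th0) <= Num.sqrt l -> `|tnth th0 k| / 2 <= `|tnth th k|.
Proof.
move=> l0 lT /sum_le_of_norm2; move=> /(_ l0) sl.
have kl : (tnth th k - tnth th0 k) ^+ 2 <= l.
  apply: le_trans sl; rewrite (bigD1 k)//= lerDl.
  by apply: sumr_ge0 => j _; exact: sqr_ge0.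
have h : `|tnth th k - tnth th0 k| <= `|tnth th0 k| / 2.
  rewrite -(@ler_pXn2r _ 2)// ?nnegrE ?divr_ge0// real_normK ?num_real//.
  rewrite expr_div_n real_normK ?num_real// ler_pdivlMr// -natrX.
  by apply: le_trans lT; rewrite mulrC ler_wpM2l.
have : `|tnth th0 k| <= `|tnth th k| + `|tnth th k - tnth th0 k|.
  by rewrite -{1}(subKr (tnth th k) (tnth th0 k)) ler_normB.
lra.
Qed.
End ball.

Section ball_mass.
Context {R : realType} (lambda : R) (P g : probability (measurableTypeR R) R).
Hypothesis lambda_gt0 : 0 < lambda.
Hypothesis g_exp : forall A : set (measurableTypeR R), measurable A ->
  g A = exponential_prob lambda A.
Hypothesis P_pos : P (`]-oo, 0%R]%classic : set R) = 0%E.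
Context (n : nat) (k : 'I_n) (th0 : vec R n).
Hypothesis th0_k : forall j, j != k -> tnth th0 j = 0.
Implicit Types y th : vec R n.

Definition large_signal : set (vec R n) :=
  [set th | `|tnth th0 k| / 2 <= `|tnth th k|].

Lemma measurable_abs_ge (c : R) : measurable [set x : measurableTypeR R | c <= `|x|].
Proof. by have := measurable_dist_ge 0 c; under eq_set do rewrite subr0. Qed.

Lemma measurable_large_signal : measurable large_signal.
Proof.
rewrite -[X in measurable X]setTI.
exact: (@measurable_tnth _ (measurableTypeR R) n k measurableT _
  (measurable_abs_ge (`|tnth th0 k| / 2))).
Qed.

Definition small_scale_mass (t1 : R) y : \bar R :=
  (\int[P]_(t in `]0%R, t1])
     scale_mass g n (fun th => (\1_large_signal th * likelihood y th)%:E) t)%E.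

(** The first term is a multiple of the evidence, which cancels in the posterior; only
    [small_scale_mass] will have to be compared with a lower bound of the evidence. *)
Lemma bayes_mass_ball_le (l t1 : R) y : 0 <= l -> 4 * l <= tnth th0 k ^+ 2 ->
  0 < t1 -> t1 <= 1 ->
  (bayes_mass (gl_prior P g n) y [set th | (norm2 (subt th th0) <= Num.sqrt l)%R] <=
   (expR (3 * l / t1) * \prod_(j < n) noise_factor lambda n k j (tnth y j))%:E *
     bayes_mass (gl_prior P g n) y setT + small_scale_mass t1 y)%E.
Proof.
move=> l0 lT t10 t11; set B := [set th | _].
have mB : measurable B by exact: measurable_ball2.
have U : (`]0%R, +oo[%classic : set R) = `]0%R, t1]%classic `|` `]t1, +oo[%classic.
  apply/seteqP; split => x /=; rewrite !in_itv/= !andbT.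
    by move=> ->; case: leP; [left|right].
  by case=> [/andP[]//|]; exact: lt_trans.
have mF A : measurable A -> measurable_fun [set: measurableTypeR R]
    (scale_mass g n (fun th => (\1_A th * likelihood y th)%:E)).
  move=> mA; apply: measurable_scale_mass.
    exact: measurable_indic_likelihood.
  exact: indic_likelihood_ge0.
have F0 A t : (0 <= scale_mass g n (fun th => (\1_A th * likelihood y th)%:E) t)%E.
  by apply: scale_mass_ge0 => th; exact: indic_likelihood_ge0.
rewrite (bayes_massE _ _ _ P_pos _ _ mB) U.
rewrite ge0_integral_setU; first last.
- apply/disj_setPS => x /= []; rewrite !in_itv/= => /andP[_ xb].
  by rewrite andbT ltNge xb.
- by move=> t _; exact: F0.
- exact: measurable_funTS (mF _ mB).
- exact: measurable_itv.
- exact: measurable_itv.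
rewrite addeC; apply: leeD; last first.
  apply: ge0_le_integral.
  - exact: measurable_itv.
  - by move=> t _; exact: F0.
  - exact: measurable_funTS (mF _ mB).
  - exact: measurable_funTS (mF _ measurable_large_signal).
  move=> t _; apply: scale_mass_le => th; first exact: indic_likelihood_ge0.
  rewrite lee_fin ler_wpM2r ?likelihood_ge0// !indicE.
  have [/set_mem Bth|_] := boolP (th \in B); last by rewrite ler0n.
  by rewrite mem_set//; exact: norm2_signal_ge Bth.
have c0 : (0 <= (expR (3 * l / t1) *
    \prod_(j < n) noise_factor lambda n k j (tnth y j))%:E)%E.
  rewrite lee_fin mulr_ge0 ?expR_ge0// prodr_ge0// => j _.
  exact: noise_factor_ge0.
have mE := measurable_total_evidence g n y.
have E0 := total_evidence_ge0 g n y.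
rewrite (bayes_evidenceE _ _ _ P_pos) -ge0_integralZl//; last exact: measurable_funTS.
apply: (@le_trans _ _ (\int[P]_(t in `]t1, +oo[)
  ((expR (3 * l / t1) * \prod_(j < n) noise_factor lambda n k j (tnth y j))%:E *
   total_evidence g n y t))%E).
  apply: ge0_le_integral => //.
  - exact: measurable_funTS (mF _ mB).
  - by apply: emeasurable_funM => //; exact: measurable_funTS.
  move=> t /=; rewrite in_itv/= andbT => t1t.
  apply: scale_mass_noise => //; first exact: ltW.
  by move=> th; exact: norm2_noise_le.
apply: ge0_subset_integral => //.
- by apply: emeasurable_funM => //; exact: measurable_funTS.
- by move=> t _; exact: mule_ge0.
- by move=> t; rewrite U; right.
Qed.
End ball_mass.

(** * Likelihood ratios and small global scales *)

Section likelihood_ratio.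
Context {R : realType} (n : nat) (th0 : vec R n).
Implicit Types y th : vec R n.

Definition likelihood_ratio y th : R := likelihood y th / likelihood y th0.

Lemma likelihood_ratio_ge0 y th : 0 <= likelihood_ratio y th.
Proof. by rewrite divr_ge0 ?likelihood_ge0. Qed.

Lemma likelihood_ratioE y th : likelihood_ratio y th =
  \prod_(j < n) expR (((tnth y j - tnth th0 j) ^+ 2 - (tnth y j - tnth th j) ^+ 2) / 2).
Proof.
rewrite /likelihood_ratio /likelihood -prodf_div; apply: eq_bigr => j _.
have := @gauss_pdfE R; rewrite /gauss_pdf => /[dup] +
  /(_ (tnth th0 j) 1 (tnth y j) ltr01).
move=> /(_ (tnth th j) 1 (tnth y j) ltr01); rewrite sqrtr1 => -> ->.
rewrite invr1 !mulr1 -mulf_div divff ?mul1r; last first.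
  by rewrite gt_eqF// normal_peak_gt0// oner_neq0.
by rewrite -expRN -expRD; congr expR; field.
Qed.

Lemma measurable_likelihood_ratio :
  measurable_fun [set: vec R n * vec R n] (fun z => likelihood_ratio z.1 z.2).
Proof.
under eq_fun do rewrite likelihood_ratioE.
apply: measurable_prod => j _; apply: measurableT_comp => //.
have m1 : measurable_fun [set: vec R n * vec R n] (fun z => tnth z.1 j).
  exact: (measurableT_comp (@measurable_tnth _ (measurableTypeR R) n j) measurable_fst).
have m2 : measurable_fun [set: vec R n * vec R n] (fun z => tnth z.2 j).
  exact: (measurableT_comp (@measurable_tnth _ (measurableTypeR R) n j) measurable_snd).
apply: measurable_funM => //; apply: measurable_funB; apply: measurable_funX;
  exact: measurable_funB.
Qed.

(** The ratio is the density of [normal_means th] with respect to [normal_means th0]; this is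
    checked one coordinate at a time. *)
Lemma expectation_likelihood_ratio th :
  (\int[normal_means th0]_y (likelihood_ratio y th)%:E = 1)%E.
Proof.
pose h j (x : R) : \bar R :=
  (expR (((x - tnth th0 j) ^+ 2 - (x - tnth th j) ^+ 2) / 2))%:E.
have mh j : measurable_fun setT (h j).
  apply/measurable_EFinP; apply: measurableT_comp => //.
  by apply: measurable_funM => //; apply: measurable_funB; apply: measurable_funX;
    exact: measurable_funB.
have h0 j x : (0 <= h j x)%E by rewrite lee_fin expR_ge0.
transitivity (\int[normal_means th0]_y \prod_(j < n) h j (tnth y j))%E.
  by apply: eq_integral => y _; rewrite likelihood_ratioE prodEFin.
rewrite /normal_means integral_prod_prob// big1// => j _.
have := integral_normal_prob (tnth th0 j) 1 _ (mh j) (h0 j); rewrite sqrtr1 => ->.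
rewrite -[RHS](integral_gauss_pdf (tnth th j) 1)//.
apply: eq_integral => x _; rewrite -EFinM; congr EFin.
rewrite !gauss_pdfE// mulrCA -expRD.
have -> // : ((x - tnth th0 j) ^+ 2 - (x - tnth th j) ^+ 2) / 2 +
  - (x - tnth th0 j) ^+ 2 / (2 * 1) = - (x - tnth th j) ^+ 2 / (2 * 1) by field.
Qed.
End likelihood_ratio.

Section small_scale.
Context {R : realType} (lambda : R) (P g : probability (measurableTypeR R) R).
Hypothesis lambda_gt0 : 0 < lambda.
Hypothesis g_exp : forall A : set (measurableTypeR R), measurable A ->
  g A = exponential_prob lambda A.
Context (n : nat) (k : 'I_n) (th0 : vec R n).
Implicit Types y th : vec R n.

Local Notation scales := (measurableTypeR R * vec R n)%type.

(** [gl_kernel] with an idle parameter y: the integrand [F] depends on y, and measurability jointly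
    in y and the scales needs a kernel on their product. *)
Definition gl_kernel_snd (yz : vec R n * scales) :
  {measure set (vec R n) -> \bar R} := gl_kernel yz.2.

Let measurable_gl_kernel_snd (A : set (vec R n)) : measurable A ->
  measurable_fun [set: vec R n * scales] (fun yz => gl_kernel_snd yz A).
Proof.
move=> mA; exact: (measurableT_comp (measurable_gl_kernel mA) measurable_snd).
Qed.

HB.instance Definition _ := isKernel.Build _ _ _ _ R gl_kernel_snd
  measurable_gl_kernel_snd.

Let gl_kernel_snd_setT yz : gl_kernel_snd yz setT = 1%E.
Proof. exact: probability_setT. Qed.

HB.instance Definition _ := Kernel_isProbability.Build _ _ _ _ R
  gl_kernel_snd gl_kernel_snd_setT.

Let A := large_signal n k th0.
Let F y th : \bar R := (\1_A th * likelihood_ratio n th0 y th)%:E.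

Let F0 y th : (0 <= F y th)%E.
Proof. by rewrite lee_fin mulr_ge0// likelihood_ratio_ge0. Qed.

Let mF2 : measurable_fun [set: vec R n * vec R n] (fun z => F z.1 z.2).
Proof.
apply/measurable_EFinP; apply: measurable_funM.
  have mI : measurable_fun setT (\1_A : vec R n -> R).
    exact: measurable_indic (measurable_large_signal _ _ _).
  exact: (measurableT_comp mI measurable_snd).
exact: measurable_likelihood_ratio.
Qed.

Let mF y : measurable_fun setT (F y).
Proof. exact: (measurableT_comp mF2 (measurable_pair1 y)). Qed.

(** The restriction on tau is written as an indicator, so that the mass is an integral over the
    whole product space and Tonelli's theorem applies. *)
Let K t1 (yz : vec R n * scales) : \bar R :=
  ((\1_(`]0%R, t1]%classic : set R) yz.2.1)%:E * conditional_mass n (F yz.1) yz.2)%E.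

Let K0 t1 yz : (0 <= K t1 yz)%E.
Proof. by rewrite mule_ge0 ?lee_fin//; exact: conditional_mass_ge0. Qed.

Let mK t1 : measurable_fun [set: vec R n * scales] (K t1).
Proof.
apply: emeasurable_funM.
  apply/measurable_EFinP.
  have mI : measurable_fun setT (\1_(`]0%R, t1]%classic : set R) :
      measurableTypeR R -> R).
    exact: measurable_indic.
  exact: (measurableT_comp mI (measurableT_comp measurable_fst measurable_snd)).
apply: (@measurable_fun_integral_finite_kernel _ _ _ _ _
  (fun w : (vec R n * scales) * vec R n => F w.1.1 w.2) gl_kernel_snd).
  by move=> z; exact: F0.
have mp : measurable_fun setT (fun w : (vec R n * scales) * vec R n => (w.1.1, w.2)).
  apply: measurable_fun_pair => //.
  exact: (measurableT_comp measurable_fst measurable_fst).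
exact: (measurableT_comp mF2 mp).
Qed.

Let K1 t1 y : measurable_fun [set: scales] (fun z => K t1 (y, z)).
Proof. exact: (measurableT_comp (mK t1) (measurable_pair1 y)). Qed.

Let Z : probability scales R := (P \x prod_prob (fun _ : 'I_n => g))%E.

Lemma small_scale_massE t1 y :
  (small_scale_mass P g n k th0 t1 y * ((likelihood y th0)^-1)%:E =
   \int[Z]_z K t1 (y, z))%E.
Proof.
have mL : measurable_fun setT (fun th => (\1_A th * likelihood y th)%:E).
  apply: measurable_indic_likelihood; exact: measurable_large_signal.
have L0 := @indic_likelihood_ge0 R n A y.
have i0 : 0 <= (likelihood y th0)^-1 by rewrite invr_ge0 likelihood_ge0.
rewrite /Z fubini_tonelli1; [|exact: K1|by move=> z; exact: K0].
rewrite muleC /small_scale_mass -ge0_integralZl//; last 2 first.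
- apply: measurable_funTS; exact: measurable_scale_mass.
- by move=> t _; exact: scale_mass_ge0.
rewrite integral_mkcond; apply: eq_integral => t _.
rewrite /fubini_F patchE /K/= indicE; case: ifP => _; last first.
  by rewrite integral0_eq// => psi _; rewrite mul0e.
rewrite -scale_massZ// /scale_mass; apply: eq_integral => psi _.
rewrite mul1e; congr (conditional_mass n _ _); apply/funext => th.
by rewrite -EFinM mulrCA [_ * likelihood y th]mulrC.
Qed.

Lemma measurable_small_scale_ratio t1 :
  measurable_fun setT (fun y =>
    small_scale_mass P g n k th0 t1 y * ((likelihood y th0)^-1)%:E)%E.
Proof.
under eq_fun do rewrite small_scale_massE.
by apply: (@measurable_fun_fubini_tonelli_F _ _ _ _ _ Z (K t1)).
Qed.

(** The integral over y is moved inside, first past the scales and then past theta. There the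
    likelihood ratio integrates to 1, which leaves a prior probability free of the data. *)
Lemma expectation_small_scale_ratio t1 :
  (\int[normal_means th0]_y
     (small_scale_mass P g n k th0 t1 y * ((likelihood y th0)^-1)%:E) =
   \int[Z]_z ((\1_(`]0%R, t1]%classic : set R) z.1)%:E * conditional_law n z A))%E.
Proof.
under eq_integral do rewrite small_scale_massE.
rewrite (@fubini_tonelli _ _ _ _ _ (normal_means th0) Z (K t1) (mK t1) (K0 t1)).
have F20 w : (0 <= F w.1 w.2)%E by exact: F0.
apply: eq_integral => z _; rewrite /K/= ge0_integralZl//; last 2 first.
- exact: (@measurable_fun_fubini_tonelli_F _ _ _ _ _ (conditional_law n z)
    (fun w => F w.1 w.2)).
- by move=> y _; exact: conditional_mass_ge0.
congr (_ * _)%E; rewrite /conditional_mass.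
rewrite (@fubini_tonelli _ _ _ _ _ (normal_means th0) (conditional_law n z)
  (fun w => F w.1 w.2) mF2 F20)/=.
transitivity (\int[conditional_law n z]_th (\1_A th)%:E)%E; last first.
  by rewrite integral_indic ?setIT//; exact: measurable_large_signal.
apply: eq_integral => th _; rewrite /F.
under eq_integral do rewrite EFinM.
rewrite ge0_integralZl//; last 2 first.
- apply/measurable_EFinP.
  exact: (measurableT_comp (measurable_likelihood_ratio n th0) (measurable_pair2 th)).
- by move=> y _; rewrite lee_fin likelihood_ratio_ge0.
by rewrite expectation_likelihood_ratio mule1.
Qed.

Lemma conditional_law_large_signal z :
  conditional_law n z A = normal_prob 0 (Num.sqrt (tnth z.2 k * z.1))
    [set x : R | (`|tnth th0 k| / 2 <= `|x|)%R].
Proof.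
rewrite /conditional_law /A /large_signal.
exact: (prod_prob_coord n (fun j => normal_prob 0 (Num.sqrt (tnth z.2 j * z.1))) k _
  (measurable_abs_ge _)).
Qed.

(** A large theta_k has two possible causes: psi_k exceeds [m], or a Gaussian of variance at most
    [m * t1] exceeds half the signal. The level [m] stays free so that the two exponents can be
    balanced later. *)
Lemma expectation_small_scale_ratio_le (t1 m : R) : 0 < t1 -> 0 < m ->
  (\int[normal_means th0]_y
     (small_scale_mass P g n k th0 t1 y * ((likelihood y th0)^-1)%:E) <=
   (expR (- lambda * m) +
    Num.sqrt 2 * expR (- tnth th0 k ^+ 2 / (16 * m * t1)))%:E)%E.
Proof.
move=> t10 m0; rewrite expectation_small_scale_ratio.
set c := Num.sqrt 2 * _.
have c0 : 0 <= c by rewrite mulr_ge0 ?sqrtr_ge0 ?expR_ge0.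
(* The null event psi_k <= 0 is put into the exceptional set, so that the variance is positive off
   it, as [gauss_tail] requires. *)
pose S : set (measurableTypeR R) := `]-oo, 0%R]%classic `|` `]m, +oo[%classic.
have mS : measurable S by apply: measurableU; exact: measurable_itv.
pose S' : set scales := setT `*` [set psi : vec R n | S (tnth psi k)].
have mSn : measurable [set psi : vec R n | S (tnth psi k)].
  rewrite -[X in measurable X]setTI.
  exact: (@measurable_tnth _ (measurableTypeR R) n k measurableT _ mS).
have mS' : measurable S' by exact: measurableX.
have gS : (Z S' <= (expR (- lambda * m))%:E)%E.
  have -> : (Z S' = P setT * prod_prob (fun=> g) [set psi : vec R n | S (tnth psi k)])%E.
    exact: product_measure1E.
  rewrite probability_setT mul1e.
  have -> : prod_prob (fun=> g) [set psi : vec R n | S (tnth psi k)] = g S.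
    exact: (prod_prob_coord n (fun=> g) k _ mS).
  have h : (g S <= g (`]-oo, 0%R]%classic : set R) + g (`]m, +oo[%classic : set R))%E.
    exact: measureU2.
  by apply: (le_trans h); rewrite (expo_Nyo0 _ _ g_exp) add0e (expo_boy _ _ g_exp).
apply: (@le_trans _ _ (\int[Z]_z ((\1_S' z)%:E + c%:E))%E).
  apply: le_integral_ge0 => z; first by rewrite mule_ge0// lee_fin.
  rewrite conditional_law_large_signal indicE.
  have [/set_mem|_] := boolP (_ \in _); last first.
    by rewrite mul0e -EFinD lee_fin addr_ge0.
  rewrite /= in_itv/= mul1e => /andP[z0 zt1].
  have [zS|zS] := pselect (S (tnth z.2 k)).
    rewrite indicE mem_set ?split//= -EFinD.
    apply: le_trans (probability_le1 _ (measurable_abs_ge _)) _.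
    by rewrite lee_fin lerDl.
  have [p0 pm] : 0 < tnth z.2 k /\ tnth z.2 k <= m.
    split; first by rewrite ltNge; apply/negP => h; apply: zS; left; rewrite /= in_itv.
    by rewrite leNgt; apply/negP => h; apply: zS; right; rewrite /= in_itv/= h.
  have s0 : 0 < tnth z.2 k * z.1 by exact: mulr_gt0.
  have := gauss_tail 0 _ (`|tnth th0 k| / 2) s0.
  under eq_set do rewrite subr0.
  have T0 : 0 <= `|tnth th0 k| / 2 by rewrite divr_ge0.
  move=> /(_ T0) tail; apply: (le_trans tail).
  apply: (@le_trans _ _ c%:E); last by rewrite leeDr// lee_fin.
  rewrite lee_fin ler_wpM2l ?sqrtr_ge0// ler_expR !mulNr lerN2.
  rewrite expr_div_n real_normK ?num_real//.
  rewrite -[leRHS]mulrA -invfM ler_wpM2l ?sqr_ge0// lef_pV2 ?posrE ?mulr_gt0//.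
  have : tnth z.2 k * z.1 <= m * t1 by apply: ler_pM => //; exact: ltW.
  rewrite -natrX; lra.
rewrite ge0_integralD//; last by apply/measurable_EFinP; exact: measurable_indic.
rewrite integral_indic// setIT integral_cst//.
rewrite [X in (_ + _ * X)%E](_ : _ = 1%E) ?mule1; last exact: probability_setT.
by rewrite EFinD leeD.
Qed.
End small_scale.

(** * The denominator of the posterior *)

Section evidence.
Context {R : realType} (lambda : R) (P g : probability (measurableTypeR R) R).
Hypothesis lambda_gt0 : 0 < lambda.
Hypothesis g_exp : forall A : set (measurableTypeR R), measurable A ->
  g A = exponential_prob lambda A.
Hypothesis P_pos : P (`]-oo, 0%R]%classic : set R) = 0%E.
Context (n : nat) (k : 'I_n) (th0 : vec R n).
Hypothesis th0_k : forall j, j != k -> tnth th0 j = 0.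
Implicit Types y : vec R n.

(** Cost of a null coordinate when psi is kept in []0, a]] and t is at most [2 * t0]: the exponent
    is half of the largest variance, 2 a t0. *)
Definition noise_evidence (a t0 : R) : R :=
  (1 - expR (- lambda * a)) * expR (- a * t0).

(** The bound of [coord_evidence_ge_large] without the Gaussian peak, at the worst observation
    allowed, |y_k| = 2 |T|; hence 2 T^2 / (H t0). *)
Definition signal_evidence (H t0 : R) : R :=
  expR (- lambda * H) * (1 - expR (- lambda * H)) *
  expR (- 2 * H * t0 - 2 * tnth th0 k ^+ 2 / (H * t0)).

Lemma one_sub_expR_gt0 (x : R) : 0 < x -> 0 < 1 - expR (- lambda * x).
Proof. by move=> x0; rewrite subr_gt0 -expR0 ltr_expR mulNr oppr_lt0 mulr_gt0. Qed.

Lemma noise_evidence_gt0 a t0 : 0 < a -> 0 < noise_evidence a t0.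
Proof. by move=> a0; rewrite mulr_gt0 ?expR_gt0// one_sub_expR_gt0. Qed.

Lemma noise_evidence_le1 a t0 : 0 < a -> 0 < t0 -> noise_evidence a t0 <= 1.
Proof.
move=> a0 t00; rewrite /noise_evidence mulr_ile1 ?expR_ge0//.
- by rewrite ltW// one_sub_expR_gt0.
- by rewrite -expR0 ler_expR mulNr oppr_le0 mulr_ge0// ltW.
Qed.

Lemma signal_evidence_gt0 H t0 : 0 < H -> 0 < signal_evidence H t0.
Proof.
by move=> H0; rewrite mulr_gt0 ?expR_gt0// mulr_gt0 ?expR_gt0// one_sub_expR_gt0.
Qed.

Lemma total_evidence_ge a H t0 t y : 0 < a -> 0 < H -> 0 < t0 -> t0 <= t <= 2 * t0 ->
  `|tnth y k| <= 2 * `|tnth th0 k| ->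
  ((noise_evidence a t0 ^+ n * signal_evidence H t0 * likelihood y th0)%:E <=
   total_evidence g n y t)%E.
Proof.
move=> a0 H0 t00 t0t yk; have t'0 : 0 < t by case/andP: t0t => /(lt_le_trans t00).
pose c (j : 'I_n) := if j == k then signal_evidence H t0 else 1.
have -> : noise_evidence a t0 ^+ n * signal_evidence H t0 * likelihood y th0 =
    \prod_(j < n) (noise_evidence a t0 * c j * gauss_pdf (tnth th0 j) 1 (tnth y j)).
  rewrite big_split/= big_split/= prodr_const card_ord; congr (_ * _ * _).
    by rewrite (bigD1 k)//= big1 /c ?eqxx ?mulr1// => j /negbTE ->.
  by apply: eq_bigr => j _; rewrite /gauss_pdf sqrtr1.
have q0 := noise_evidence_gt0 a t0 a0; have q1 := noise_evidence_le1 _ _ a0 t00.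
have s0 := signal_evidence_gt0 H t0 H0.
rewrite -prodEFin; apply: lee_prode => j.
  rewrite lee_fin mulr_ge0 ?gauss_pdf_ge0// mulr_ge0 ?ltW// /c.
  by case: ifP.
rewrite /c; case: ifPn => [/eqP ->|jk].
  apply: le_trans (coord_evidence_ge_large lambda _ g_exp _ _ _ _ H0 t00 t0t).
  rewrite lee_fin -[X in X <= _]mulrA.
  (* One [noise_evidence] factor, at most 1, is spent on the coordinate [k] too, so that the
     exponent is [n] rather than n - 1. *)
  apply: (@le_trans _ _ (1 * (signal_evidence H t0 *
      gauss_pdf (tnth th0 k) 1 (tnth y k)))).
    by apply: ler_wpM2r => //; apply: mulr_ge0; [exact: ltW|exact: gauss_pdf_ge0].
  rewrite mul1r /signal_evidence -mulrA; apply: ler_wpM2l.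
    by rewrite mulr_ge0 ?expR_ge0// ltW// one_sub_expR_gt0.
  rewrite mulrC; apply: ler_pM; rewrite ?expR_ge0 ?gauss_pdf_ge0 ?gauss_pdf_ub//.
  rewrite ler_expR lerD2l lerN2.
  have -> : 2 * tnth th0 k ^+ 2 / (H * t0) = (2 * `|tnth th0 k|) ^+ 2 / (2 * (H * t0)).
    by rewrite exprMn real_normK ?num_real//; field; rewrite !gt_eqF.
  rewrite ler_wpM2r ?invr_ge0 ?mulr_ge0 ?(ltW H0) ?(ltW t00)//.
  by rewrite -(real_normK (num_real (tnth y k))) ler_pXn2r ?nnegrE ?mulr_ge0.
apply: le_trans (coord_evidence_ge_small lambda _ g_exp a _ _ t'0 a0).
rewrite lee_fin mulr1 th0_k// /noise_evidence -mulrA ler_wpM2l//.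
  by rewrite ltW// one_sub_expR_gt0.
rewrite ler_wpM2r ?gauss_pdf_ge0// ler_expR.
case/andP: t0t => _ /(ler_wpM2l (ltW a0)); lra.
Qed.

Lemma bayes_evidence_ge c a H t0 y :
  0 <= c -> ((c * t0)%:E <= P (`]t0, (2 * t0)%R]%classic : set R))%E ->
  0 < a -> 0 < H -> 0 < t0 -> `|tnth y k| <= 2 * `|tnth th0 k| ->
  ((c * t0 * (noise_evidence a t0 ^+ n * signal_evidence H t0) * likelihood y th0)%:E <=
   bayes_mass (gl_prior P g n) y setT)%E.
Proof.
move=> c0 cP a0 H0 t00 yk.
set e := noise_evidence a t0 ^+ n * signal_evidence H t0.
have el0 : 0 <= e * likelihood y th0.
  by rewrite mulr_ge0 ?likelihood_ge0// mulr_ge0 ?exprn_ge0// ltW//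
    (noise_evidence_gt0, signal_evidence_gt0).
rewrite (bayes_evidenceE _ _ _ P_pos) -mulrA mulrC EFinM.
apply: (@le_trans _ _ ((e * likelihood y th0)%:E *
  P (`]t0, (2 * t0)%R]%classic : set R))%E).
  by rewrite lee_wpmul2l// lee_fin.
apply: cst_mul_le_integral => //.
- by move=> x /=; rewrite !in_itv/= => /andP[/(lt_trans t00) ->].
- exact: measurable_funTS (measurable_total_evidence g n y).
- by move=> t _; exact: total_evidence_ge0.
move=> t /=; rewrite in_itv/= => /andP[/ltW t0t t2t].
by apply: total_evidence_ge; rewrite ?t0t.
Qed.
End evidence.

(** * Average shrinkage of a null coordinate *)

Section noise_rate.
Context {R : realType} (lambda : R).

(** The mean of [noise_factor] at a standard normal observation, see [integral_noise_factor]. *)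
Definition noise_rate : R :=
  1 - (1 - shrink_rate lambda) * fine (normal_prob 0 1 [set x : R | `|x| <= 1]).

Let measurable_abs_le1 : measurable [set x : measurableTypeR R | `|x| <= 1].
Proof.
have mh : measurable_fun setT (fun x : R => `|x|) by [].
rewrite (_ : [set x | _] = setT `&` (fun x : R => `|x|) @^-1` `]-oo, 1%R]).
  exact: mh.
by apply/seteqP; split => x; rewrite /= in_itv/= => // -[].
Qed.

(** The event |x| <= 1 has positive probability, since the normal density is bounded below on the
    unit interval. *)
Lemma noise_rate_lt1 : noise_rate < 1.
Proof.
rewrite /noise_rate ltrBlDr ltrDl mulr_gt0 ?subr_gt0 ?shrink_rate_lt1//.
rewrite -lte_fin fineK; last exact: fin_num_measure.
pose c : R := normal_peak 1 * expR (- 1 / 2).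
have c0 : 0 < c by rewrite mulr_gt0 ?expR_gt0// normal_peak_gt0// oner_neq0.
apply: (@lt_le_trans _ _ (c%:E * lebesgue_measure (`[0%R, 1%R]%classic : set R))%E).
  by rewrite lebesgue_measure_itv/= lte_fin ltr01 oppr0 adde0 mule1 lte_fin.
apply: cst_mul_le_integral => //.
- by move=> x /=; rewrite in_itv/= => /andP[x0 x1]; rewrite ger0_norm.
- by apply: measurable_funTS; apply/measurable_EFinP; exact: measurable_normal_pdf.
- by move=> x _; rewrite lee_fin normal_pdf_ge0.
- by rewrite lee_fin ltW.
move=> x /=; rewrite in_itv/= => /andP[x0 x1].
have := @gauss_pdf01_ge R x; rewrite /gauss_pdf sqrtr1 lee_fin; apply.
by rewrite ger0_norm.
Qed.

Let hit_le1 : fine (normal_prob 0 1 [set x : R | `|x| <= 1]) <= 1.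
Proof.
rewrite -lee_fin fineK; last exact: fin_num_measure.
exact: probability_le1.
Qed.

Lemma noise_rate_ge0 : 0 <= noise_rate.
Proof.
rewrite subr_ge0 mulr_ile1//; first by rewrite subr_ge0 ltW// shrink_rate_lt1.
  exact: fine_ge0.
by rewrite gerBl ltW// shrink_rate_gt0.
Qed.

Lemma measurable_noise_factor n (k j : 'I_n) :
  measurable_fun [set: R] (fun x => (noise_factor lambda n k j x)%:E).
Proof.
rewrite /noise_factor; case: (j != k) => //=.
apply/measurable_EFinP; apply: measurable_fun_ifT => //=.
by apply: measurable_fun_ler.
Qed.

Lemma integral_noise_factor n (k j : 'I_n) : j != k ->
  (\int[normal_prob 0 1]_x (noise_factor lambda n k j x)%:E = noise_rate%:E)%E.
Proof.
move=> jk; pose S := [set x : measurableTypeR R | `|x| <= 1].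
transitivity (\int[normal_prob (0 : R) 1]_x
    ((shrink_rate lambda)%:E * (\1_S x)%:E + (\1_(~` S) x)%:E))%E.
  apply: eq_integral => x _; rewrite /noise_factor jk/= !indicE in_setC.
  have [xS|xS] := boolP (`|x| <= 1).
    by rewrite mem_set//= mule1 adde0.
  by rewrite memNset/= ?mule0 ?add0e//; exact/negP.
have mS : measurable S by exact: measurable_abs_le1.
have mCS : measurable (~` S) by exact: measurableC.
rewrite ge0_integralD//; last 3 first.
- by move=> x _; rewrite mule_ge0 ?lee_fin// ltW// shrink_rate_gt0.
- apply: emeasurable_funM => //; apply/measurable_EFinP; exact: measurable_indic.
- by apply/measurable_EFinP; exact: measurable_indic.
rewrite ge0_integralZl//; last 2 first.
- by apply/measurable_EFinP; exact: measurable_indic.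
- by rewrite lee_fin ltW// shrink_rate_gt0.
have hC : (normal_prob (0 : R) 1 (~` S) = 1 - normal_prob (0 : R) 1 S)%E.
  exact: probability_setC.
rewrite !integral_indic// !setIT [X in (_ + X)%E]hC.
have /fineK : normal_prob (0 : R) 1 S \is a fin_num by exact: fin_num_measure.
rewrite /noise_rate -/S; set p := fine _ => pE.
rewrite -[X in (_ + (_ - X))%E]pE [X in (_ * X + _)%E](_ : _ = p%:E)//.
by rewrite -EFinM -EFinB -EFinD; congr EFin; ring.
Qed.
End noise_rate.

(** * Bound at a fixed sample size *)

Section finite_sample_bound.
Context {R : realType} (lambda : R) (P g : probability (measurableTypeR R) R).
Hypothesis lambda_gt0 : 0 < lambda.
Hypothesis g_exp : forall A : set (measurableTypeR R), measurable A ->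
  g A = exponential_prob lambda A.
Hypothesis P_pos : P (`]-oo, 0%R]%classic : set R) = 0%E.
Context (n : nat) (k : 'I_n) (th0 : vec R n).
Hypothesis th0_k : forall j, j != k -> tnth th0 j = 0.
Implicit Types y : vec R n.

Let nf y : R := \prod_(j < n) noise_factor lambda n k j (tnth y j).

Let nf_ge0 y : 0 <= nf y.
Proof. by apply: prodr_ge0 => j _; exact: noise_factor_ge0. Qed.

Let measurable_nf : measurable_fun setT (fun y => (nf y)%:E).
Proof.
under eq_fun do rewrite /nf -prodEFin.
apply: (measurable_prod_tnth n (fun j x => (noise_factor lambda n k j x)%:E)) => j.
exact: measurable_noise_factor.
Qed.

Lemma expectation_noise_factor :
  (\int[normal_means th0]_y (\prod_(j < n) noise_factor lambda n k j (tnth y j))%:E =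
   (noise_rate lambda ^+ n.-1)%:E)%E.
Proof.
pose h j x := (noise_factor lambda n k j x)%:E.
have mh j : measurable_fun setT (h j) by exact: measurable_noise_factor.
have h0 j x : (0 <= h j x)%E by rewrite lee_fin noise_factor_ge0.
transitivity (\int[normal_means th0]_y \prod_(j < n) h j (tnth y j))%E.
  by apply: eq_integral => y _; rewrite prodEFin.
rewrite /normal_means integral_prod_prob// (bigD1 k)//=.
rewrite (eq_bigr (fun=> (noise_rate lambda)%:E)); last first.
  by move=> j jk; rewrite th0_k// integral_noise_factor.
rewrite prodEFin prodr_const cardC1 card_ord.
rewrite [X in (X * _)%E](_ : _ = 1%E) ?mul1e//.
rewrite /h; under eq_integral do rewrite /noise_factor eqxx/=.
by rewrite integral_cst// mul1e; exact: probability_setT.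
Qed.

(** Off this event |y_k| <= 2 |T|, as the lower bound on the evidence requires; on it the posterior
    probability is bounded by 1. *)
Let far : set (vec R n) := [set y | `|tnth th0 k| <= `|tnth y k - tnth th0 k|].

Let measurable_far : measurable far.
Proof.
rewrite -[X in measurable X]setTI.
exact: (@measurable_tnth _ (measurableTypeR R) n k measurableT _
  (measurable_dist_ge (tnth th0 k) `|tnth th0 k|)).
Qed.

Let far_le : (normal_means th0 far <=
  (Num.sqrt 2 * expR (- tnth th0 k ^+ 2 / 4))%:E)%E.
Proof.
have -> : normal_means th0 far = normal_prob (tnth th0 k) 1
    [set x : R | (`|tnth th0 k| <= `|x - tnth th0 k|)%R].
  exact: (prod_prob_coord n (fun j => normal_prob (tnth th0 j) 1) k _
    (measurable_dist_ge _ _)).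
have := gauss_tail (tnth th0 k) 1 `|tnth th0 k| ltr01 (normr_ge0 _).
by rewrite sqrtr1 mulr1 real_normK ?num_real.
Qed.

(** The three summands come from large tau, from the event [far] and from small tau. The thresholds
    are left free here and tuned to the sample size in [posterior_ball_rate]. *)
Lemma posterior_ball_le (l t1 c a H t0 m : R) :
  0 <= l -> 4 * l <= tnth th0 k ^+ 2 -> 0 < t1 -> t1 <= 1 ->
  0 < c -> ((c * t0)%:E <= P (`]t0, (2 * t0)%R]%classic : set R))%E ->
  0 < a -> 0 < H -> 0 < t0 -> 0 < m ->
  (\int[normal_means th0]_y posterior (gl_prior P g n) y
     [set th | (norm2 (subt th th0) <= Num.sqrt l)%R] <=
   (expR (3 * l / t1) * noise_rate lambda ^+ n.-1 +
    Num.sqrt 2 * expR (- tnth th0 k ^+ 2 / 4) +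
    (expR (- lambda * m) +
     Num.sqrt 2 * expR (- tnth th0 k ^+ 2 / (16 * m * t1))) /
    (c * t0 * (noise_evidence lambda a t0 ^+ n *
       signal_evidence lambda n k th0 H t0)))%:E)%E.
Proof.
move=> l0 lT t10 t11 c0 cP a0 H0 t00 m0; set B := [set th | _].
set d := c * t0 * _.
have d0 : 0 < d.
  apply: mulr_gt0; first exact: mulr_gt0.
  by apply: mulr_gt0; [exact/exprn_gt0/noise_evidence_gt0|exact: signal_evidence_gt0].
have mB : measurable B by exact: measurable_ball2.
pose S y := (small_scale_mass P g n k th0 t1 y * ((likelihood y th0)^-1)%:E)%E.
have S0 y : (0 <= S y)%E.
  rewrite mule_ge0 ?lee_fin ?invr_ge0 ?likelihood_ge0//.
  apply: integral_ge0 => t _; apply: scale_mass_ge0 => th.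
  exact: indic_likelihood_ge0.
have mS : measurable_fun setT S by exact: measurable_small_scale_ratio.
set e := expR (3 * l / t1).
have e0 : 0 <= e by exact: expR_ge0.
have di0 : 0 <= d^-1 by rewrite invr_ge0 ltW.
pose G y : \bar R := (e%:E * (nf y)%:E + (\1_far y)%:E + (d^-1)%:E * S y)%E.
have PG y : (posterior (gl_prior P g n) y B <= G y)%E.
  have G1 : (0 <= e%:E * (nf y)%:E)%E by rewrite mule_ge0 ?lee_fin.
  have G3 : (0 <= (d^-1)%:E * S y)%E by rewrite mule_ge0 ?lee_fin.
  have [yf|yf] := boolP (y \in far).
    apply: (@le_trans _ _ 1%E); first exact: probability_le1.
    rewrite /G indicE yf/= -addeA; apply: (le_trans _ (leeDr _ G1)).
    exact: leeDl.
  have yk : `|tnth y k| <= 2 * `|tnth th0 k|.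
    have yd : `|tnth y k - tnth th0 k| <= `|tnth th0 k|.
      rewrite leNgt; apply/negP => h; move/negP: yf; apply.
      by rewrite inE /far/= ltW.
    have := ler_normD (tnth y k - tnth th0 k) (tnth th0 k).
    by rewrite subrK; lra.
  have [D0 Dfin ->] := posteriorE (gl_prior P g n) y B.
  have N := bayes_mass_ball_le lambda P g lambda_gt0 g_exp P_pos n k th0 th0_k l t1 y
    l0 lT t10 t11.
  have L := bayes_evidence_ge lambda P g lambda_gt0 g_exp P_pos n k th0 th0_k c a H t0 y
    (ltW c0) cP a0 H0 t00 yk.
  have Dn : bayes_mass (gl_prior P g n) y setT \is a fin_num.
    by rewrite ge0_fin_numE// ltW.
  move: D0 N L; rewrite -(fineK Dn); set D := fine _.
  rewrite lte_fin -/e -/(nf y) -/B -/d lee_fin => D0 N L.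
  have Di0 : 0 <= D^-1 by rewrite invr_ge0 ltW.
  apply: (@le_trans _ _ (((e * nf y)%:E * D%:E + small_scale_mass P g n k th0 t1 y) *
    D^-1%:E)%E).
    by rewrite lee_wpmul2r// lee_fin.
  rewrite ge0_muleDl; last 2 first.
  - by rewrite mule_ge0// lee_fin ?mulr_ge0// ltW.
  - apply: integral_ge0 => t _; apply: scale_mass_ge0 => th.
    exact: indic_likelihood_ge0.
  rewrite -muleA -[X in (_ * X + _)%E]EFinM divff ?gt_eqF// mule1.
  rewrite /G indicE (negbTE yf) adde0 EFinM; apply: leeD => //.
  rewrite /S muleCA lee_wpmul2l//.
    apply: integral_ge0 => t _; apply: scale_mass_ge0 => th.
    exact: indic_likelihood_ge0.
  rewrite -EFinM lee_fin -invfM lef_pV2 ?posrE//.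
  by rewrite mulr_gt0// likelihood_gt0.
(* Measurability in y of the posterior probability is not established; [le_integral_ge0] does not
   ask for it. *)
apply: (@le_trans _ _ (\int[normal_means th0]_y G y)%E).
  exact: le_integral_ge0.
have mI : measurable_fun setT (fun y => (\1_far y)%:E : \bar R).
  by apply/measurable_EFinP; exact: measurable_indic.
have m1 : measurable_fun setT (fun y => e%:E * (nf y)%:E)%E.
  exact: emeasurable_funM.
have m3 : measurable_fun setT (fun y => (d^-1)%:E * S y)%E.
  exact: emeasurable_funM.
have p1 y : (0 <= e%:E * (nf y)%:E)%E by rewrite mule_ge0 ?lee_fin.
have p2 y : (0 <= (\1_far y)%:E :> \bar R)%E by rewrite lee_fin.
have p3 y : (0 <= (d^-1)%:E * S y)%E by rewrite mule_ge0 ?lee_fin.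
rewrite /G ge0_integralD//; last 2 first.
- by move=> y _; rewrite adde_ge0.
- exact: emeasurable_funD.
rewrite ge0_integralD// !ge0_integralZl//; last by move=> y _; rewrite lee_fin.
rewrite expectation_noise_factor integral_indic// setIT !EFinD.
apply: leeD; first by apply: leeD => //; rewrite EFinM.
rewrite [(_ / d)%R]mulrC EFinM lee_wpmul2l ?lee_fin//.
exact: expectation_small_scale_ratio_le.
Qed.
End finite_sample_bound.

(** * Asymptotics *)

Lemma bernoulli_ineq {R : realType} (x : R) n : 0 <= x <= 1 ->
  1 - n%:R * x <= (1 - x) ^+ n.
Proof.
case/andP=> x0 x1; elim: n => [|n IH]; first by rewrite mul0r subr0.
rewrite exprS; apply: (@le_trans _ _ ((1 - x) * (1 - n%:R * x))).
  rewrite -natr1; have : 0 <= n%:R * (x * x) by rewrite !mulr_ge0.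
  lra.
by rewrite ler_wpM2l// subr_ge0.
Qed.

(** A third power, because x >= exp(L / 2) has to exceed L^2 by a further factor L that absorbs the
    constants. *)
Lemma expR_ge_cube {R : realType} (u : R) : 0 <= u -> (u / 3) ^+ 3 <= expR u.
Proof.
move=> u0; rewrite -[X in expR X](_ : 3%:R * (u / 3) = u); last by field.
rewrite expRM_natl ler_pXn2r ?nnegrE ?expR_ge0 ?divr_ge0//.
by apply: le_trans (expR_ge1Dx _); rewrite lerDr.
Qed.

Lemma expR_ge_sqr {R : realType} (u : R) : 0 <= u -> (u / 2) ^+ 2 <= expR u.
Proof.
move=> u0; rewrite -[X in expR X](_ : 2%:R * (u / 2) = u); last by field.
rewrite expRM_natl ler_pXn2r ?nnegrE ?expR_ge0 ?divr_ge0//.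
by apply: le_trans (expR_ge1Dx _); rewrite lerDr.
Qed.

Section rates.
Context {R : realType} (lambda : R).
Hypothesis lambda_gt0 : 0 < lambda.
Implicit Types (n : nat) (L : R).

(** The cutoff for psi is chosen so that its tail probability is 1 / (2 n); Bernoulli's inequality
    then keeps the n-th power above 1/2. The exponential factor costs n a t0 = a K L, and
    [ln 2 <= L] bounds a by 2 L / lambda. *)
Lemma noise_evidence_pow_ge n (B K L t0 : R) : (0 < n)%N -> n%:R = expR L -> 1 <= L ->
  0 <= K -> n%:R * t0 = K * L -> B = 2 * K / lambda ->
  2^-1 * expR (- (B * L ^+ 2)) <=
  noise_evidence lambda ((L + ln 2) / lambda) t0 ^+ n.
Proof.
move=> n0 nL L1 K0 nt0 ->; rewrite /noise_evidence exprMn.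
have ll : - lambda * ((L + ln 2) / lambda) = - (L + ln 2) by field; rewrite gt_eqF.
have nr0 : 0 < n%:R :> R by rewrite ltr0n.
have e1 : expR (- lambda * ((L + ln 2) / lambda)) = (2 * n%:R)^-1.
  by rewrite ll expRN expRD lnK ?posrE// -nL mulrC.
rewrite e1; apply: ler_pM; rewrite ?expR_ge0//.
  apply: le_trans (bernoulli_ineq _ n _); last first.
    have n20 : 0 < 2 * n%:R :> R by rewrite mulr_gt0.
    rewrite invr_ge0 (ltW n20) invf_le1//=.
    have n1 : 1 <= n%:R :> R by rewrite ler1n.
    by lra.
  by rewrite invfM mulrCA divff ?gt_eqF// mulr1; lra.
rewrite -expRM_natl ler_expR.
have l2 : ln 2 <= 1 :> R.
  by rewrite -ler_expR lnK ?posrE//; have := @expR_ge1Dx R 1; lra.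
have -> : n%:R * (- ((L + ln 2) / lambda) * t0) = - ((L + ln 2) * (n%:R * t0 / lambda)).
  by ring.
have -> : 2 * K / lambda * L ^+ 2 = (2 * L) * (K * L / lambda) by ring.
rewrite nt0 lerN2 ler_wpM2r//; last by lra.
by rewrite divr_ge0 ?mulr_ge0 ?(ltW lambda_gt0)//; lra.
Qed.

(** For H = x / sK the two competing costs are [lambda * H] and 2 T^2 / (H t0) = 2 H. The remaining
    2 H t0 is at most 2 H, which gives lambda + 4. The last hypothesis makes [lambda * H] at least
    1, so that 1 - exp(- lambda H) >= 1/2. *)
Lemma signal_evidence_ge n (k : 'I_n) (th0 : vec R n) (x sK s : R) :
  0 < x -> 0 < sK -> 0 < s -> tnth th0 k ^+ 2 = x ^+ 2 * s ->
  sK ^+ 2 * s <= 1 -> sK <= lambda * x ->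
  2^-1 * expR (- ((lambda + 4) * x / sK)) <=
  signal_evidence lambda n k th0 (x / sK) (sK ^+ 2 * s).
Proof.
move=> x0 sK0 s0 Tx t01 Hl; rewrite /signal_evidence Tx.
have q0 : 0 < x / sK by rewrite divr_gt0.
have h2 : expR (- lambda * (x / sK)) <= 2^-1.
  rewrite mulNr expRN lef_pV2 ?posrE ?expR_gt0//.
  apply: le_trans (expR_ge1Dx _).
  have : 1 <= lambda * (x / sK) by rewrite mulrA ler_pdivlMr// mul1r.
  lra.
have -> : 2 * (x ^+ 2 * s) / (x / sK * (sK ^+ 2 * s)) = 2 * (x / sK).
  by field; rewrite !gt_eqF.
rewrite [X in _ <= X * _]mulrC -[leRHS]mulrA -expRD.
apply: ler_pM; rewrite ?expR_ge0//.
  lra.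
rewrite ler_expR.
have : x / sK * (sK ^+ 2 * s) <= x / sK by rewrite ler_piMr// ltW.
have -> : (lambda + 4) * x / sK = lambda * (x / sK) + 4 * (x / sK) by ring.
lra.
Qed.
End rates.

Lemma sqrt2_le2 {R : realType} : Num.sqrt 2 <= 2 :> R.
Proof. by rewrite -[leRHS]ger0_norm// -sqrtr_sqr ler_wsqrtr//; lra. Qed.

(** The constant 6 / rho makes the price of the weight exp(n rho / 2), half of the gain in exponent.
    The surplus exp(- n rho / 2) is weakened by [L <= n]. *)
Lemma large_scale_rate {R : realType} (r rho L : R) n : (0 < n)%N ->
  n%:R = expR L -> 0 < L -> 0 <= r -> r <= expR (- rho) -> 0 < rho ->
  expR (3 * L / (6 / rho * (L / n%:R))) * r ^+ n.-1 <=
  expR rho * expR (- (rho / 2) * L).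
Proof.
move=> n0 nL L0 r0 rr rho0; have nr0 : 0 < n%:R :> R by rewrite ltr0n.
have -> : 3 * L / (6 / rho * (L / n%:R)) = n%:R * rho / 2.
  by field; rewrite !gt_eqF.
apply: (@le_trans _ _ (expR (n%:R * rho / 2) * expR (- rho) ^+ n.-1)).
  by rewrite ler_wpM2l ?expR_ge0// lerXn2r ?nnegrE ?expR_ge0.
rewrite -expRM_natl -!expRD ler_expR.
have -> : n.-1%:R = n%:R - 1 :> R by rewrite -subn1 natrB.
have nLe : L <= n%:R by rewrite nL; apply: le_trans (expR_ge1Dx L); rewrite lerDr.
have := ler_wpM2r (ltW rho0) nLe; lra.
Qed.

(** Half of the exponent [kx] pays for the signal. The other half covers [B * L ^+ 2] for the noise,
    one L for 1 / s and one L for the rate claimed. The constant 12 is 3 times the two factors 2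
    lost in [q] and [sig]. *)
Lemma small_scale_rate {R : realType} (c K s B L kx q sig num : R) :
  0 < c -> 0 < K -> expR (- L) <= s -> 1 <= L ->
  2^-1 * expR (- (B * L ^+ 2)) <= q -> 2^-1 * expR (- (kx / 2)) <= sig ->
  num <= 3 * expR (- kx) -> (B + 2) * L ^+ 2 <= kx / 2 ->
  num / (c * (K * s) * (q * sig)) <= 12 / (c * K) * expR (- L).
Proof.
move=> c0 K0 Ls L1 qB sk numk BL.
have s0 : 0 < s by apply: lt_le_trans Ls; exact: expR_gt0.
have q0 : 0 < q by apply: lt_le_trans qB; rewrite mulr_gt0// expR_gt0.
have g0 : 0 < sig by apply: lt_le_trans sk; rewrite mulr_gt0// expR_gt0.
rewrite ler_pdivrMr; last by rewrite !mulr_gt0.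
have -> : 12 / (c * K) * expR (- L) * (c * (K * s) * (q * sig)) =
    12 * (expR (- L) * (s * (q * sig))) by field; rewrite !gt_eqF.
apply: (le_trans numk).
apply: (@le_trans _ _ (12 * (expR (- L) * (expR (- L) *
    ((2^-1 * expR (- (B * L ^+ 2))) * (2^-1 * expR (- (kx / 2)))))))).
  rewrite [leRHS](_ : _ = 3 * (expR (- L) * expR (- L) * expR (- (B * L ^+ 2)) *
    expR (- (kx / 2)))); last by field.
  rewrite ler_wpM2l// -!expRD ler_expR.
  have : L <= L ^+ 2 by rewrite expr2 ler_peMr//; lra.
  move: BL; lra.
rewrite ler_wpM2l// ler_wpM2l ?expR_ge0//.
have h1 : 0 <= 2^-1 * expR (- (B * L ^+ 2)) by rewrite mulr_ge0// expR_ge0.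
have h2 : 0 <= 2^-1 * expR (- (kx / 2)) by rewrite mulr_ge0// expR_ge0.
by apply: ler_pM; rewrite ?expR_ge0 ?mulr_ge0//; apply: ler_pM.
Qed.

Section posterior_rate.
Context {R : realType} (lambda : R) (P g : probability (measurableTypeR R) R).
Hypothesis lambda_gt0 : 0 < lambda.
Hypothesis g_exp : forall A : set (measurableTypeR R), measurable A ->
  g A = exponential_prob lambda A.
Hypothesis P_pos : P (`]-oo, 0%R]%classic : set R) = 0%E.
Context (c : R).
Hypothesis c_gt0 : 0 < c.
Hypothesis P_ge : forall t, 0 < t -> 2 * t < 1 ->
  ((c * t)%:E <= P (`]t, (2 * t)%R]%classic : set R))%E.

(** The bound is a power n^(-d), with constants chosen before [n], [k] and [th0]; the theorem
    follows by squeezing. *)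
Lemma posterior_ball_rate : exists A d L0 : R, [/\ 0 < d, 1 <= L0 &
  forall n (k : 'I_n) (th0 : vec R n),
    (forall j, j != k -> tnth th0 j = 0) -> L0 <= ln n%:R ->
    4 * ln n%:R <= tnth th0 k ^+ 2 ->
    (\int[normal_means th0]_y posterior (gl_prior P g n) y
       [set th | (norm2 (subt th th0) <= Num.sqrt (ln n%:R))%R] <=
     (A * expR (- d * ln n%:R))%:E)%E].
Proof.
pose r := noise_rate lambda; have r1 : r < 1 := noise_rate_lt1 lambda.
have r0 : 0 <= r := noise_rate_ge0 lambda.
(* C makes exp(3 n / C) negligible against r ^ n; K is large enough for the
   cost (lambda + 4) x / sqrt K of the evidence to be half of the exponent
   kap x of the prior mass of the signal, where x = T / sqrt (L / n). *)
pose rho := 1 - r; have rho0 : 0 < rho by rewrite subr_gt0.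
have rho1 : rho <= 1 by rewrite /rho; lra.
have rexp : r <= expR (- rho) by have := expR_ge1Dx (- rho); rewrite /rho; lra.
pose C := 6 / rho; have C0 : 0 < C by rewrite divr_gt0.
pose sC := Num.sqrt C; have sC0 : 0 < sC by rewrite sqrtr_gt0.
have sCC : sC ^+ 2 = C by rewrite sqr_sqrtr// ltW.
(* With t1 = C s and m = x / sC, where s = L / n, the two exponents of
   [expectation_small_scale_ratio_le] are lambda x / sC and x / (16 sC). *)
pose kap := Num.min lambda (16^-1) / sC.
have kap0 : 0 < kap by rewrite divr_gt0// lt_min lambda_gt0 invr_gt0 ltr0n.
pose sK := 2 * (lambda + 4) / kap.
have l4 : 0 < lambda + 4 by rewrite addr_gt0.
have sK0 : 0 < sK by rewrite divr_gt0// mulr_gt0.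
pose K := sK ^+ 2; have K0 : 0 < K by rewrite exprn_gt0.
pose B := 2 * K / lambda; have B0 : 0 < B by rewrite divr_gt0// mulr_gt0.
pose D := 12 / (c * K); have D0 : 0 < D by rewrite divr_gt0// mulr_gt0.
(* The summands ensure in turn L >= 1, C s <= 1, 2 K s < 1, sK <= lambda x (from x >= L / 2), and
   the domination of (B + 2) L^2 by kap x / 2; here 432 = 2 * 6^3 comes from x >= (L / 6)^3. *)
pose L0 := 1 + 4 * C + 16 * K + 2 * sK / lambda + 432 * (B + 2) / kap.
have P1 : 0 < 2 * sK / lambda by rewrite divr_gt0// mulr_gt0.
have P2 : 0 < 432 * (B + 2) / kap by apply: divr_gt0 => [|//]; lra.
exists (expR rho + 2 + D), (rho / 2), L0; split.
- by rewrite divr_gt0.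
- by rewrite /L0; lra.
move=> n k th0 th0_k; set L := ln n%:R => L0L LT.
have n0 : (0 < n)%N by exact: leq_ltn_trans (leq0n k) (ltn_ord k).
have nr0 : 0 < n%:R :> R by rewrite ltr0n.
have nL : n%:R = expR L by rewrite lnK// posrE.
have L1 : 1 <= L by move: L0L; rewrite /L0; lra.
have Lp : 0 < L by lra.
have LC : 4 * C <= L by move: L0L; rewrite /L0; lra.
have LK : 16 * K <= L by move: L0L; rewrite /L0; lra.
have LsK : 2 * sK <= lambda * L.
  have : 2 * sK / lambda <= L by move: L0L; rewrite /L0; lra.
  by rewrite ler_pdivrMr// [L * _]mulrC.
have LB : 432 * (B + 2) <= kap * L.
  have : 432 * (B + 2) / kap <= L by move: L0L; rewrite /L0; lra.
  by rewrite ler_pdivrMr// [L * _]mulrC.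
pose s := L / n%:R; have s0 : 0 < s by rewrite divr_gt0.
have ns : n%:R * s = L by rewrite /s mulrC divfK// gt_eqF.
have nL2 : L ^+ 2 / 4 <= n%:R.
  by rewrite nL; apply: le_trans (expR_ge_sqr _ (ltW Lp)); rewrite expr_div_n -natrX; lra.
have s4 : s * L <= 4.
  rewrite /s mulrAC ler_pdivrMr//; lra.
have Cs1 : C * s <= 1.
  have : 4 * C * s <= L * s by rewrite ler_pM2r.
  lra.
have Ks1 : 2 * (K * s) < 1.
  have : 16 * K * s <= L * s by rewrite ler_pM2r.
  lra.
pose T := `|tnth th0 k|.
have T2 : T ^+ 2 = tnth th0 k ^+ 2 by rewrite real_normK ?num_real.
pose x := T / Num.sqrt s.
have ss0 : 0 < Num.sqrt s by rewrite sqrtr_gt0.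
have T0 : 0 < T.
  rewrite normr_gt0; apply/eqP => Tk; move: LT; rewrite Tk expr0n/=; lra.
have x0 : 0 < x by rewrite divr_gt0.
have Tx : tnth th0 k ^+ 2 = x ^+ 2 * s.
  by rewrite -T2 /x expr_div_n sqr_sqrtr ?divfK ?gt_eqF// ltW.
(* Since s = L / n, the hypothesis T^2 >= 4 L gives x^2 = T^2 / s >= 4 n. *)
have xexp : expR (L / 2) <= x.
  rewrite -(@ler_pXn2r _ 2)// ?nnegrE ?expR_ge0 ?(ltW x0)//.
  rewrite -expRM_natl (_ : 2%:R * (L / 2) = L); last by field.
  rewrite -nL -(ler_pM2r s0) ns -Tx; lra.
have xL : L / 2 <= x.
  by apply: le_trans xexp; apply: le_trans (expR_ge1Dx _); lra.
have xcube : (B + 2) * L ^+ 2 <= kap * x / 2.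
  have h : (L / 6) ^+ 3 <= x.
    apply: le_trans xexp; have := expR_ge_cube (L / 2).
    rewrite (_ : L / 2 / 3 = L / 6); last by field.
    by apply; lra.
  have : kap * ((L / 6) ^+ 3) / 2 <= kap * x / 2.
    by rewrite ler_pM2r// ler_pM2l.
  apply: le_trans.
  have -> : kap * (L / 6) ^+ 3 / 2 = (kap * L) / 432 * L ^+ 2 by field.
  apply: ler_wpM2r; first exact: sqr_ge0.
  by rewrite ler_pdivlMr ?ltr0n// mulrC.
have sK1 : K * s <= 1 by lra.
have a0 : 0 < (L + ln 2) / lambda.
  by rewrite divr_gt0// addr_gt0// ln_gt0// ltr1n.
apply: (le_trans (posterior_ball_le lambda P g lambda_gt0 g_exp P_pos n k th0 th0_k
  L (C * s) c ((L + ln 2) / lambda) (x / sK) (K * s) (x / sC)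
  (ltW Lp) LT (mulr_gt0 C0 s0) Cs1 c_gt0 (P_ge _ (mulr_gt0 K0 s0) Ks1)
  a0 (divr_gt0 x0 sK0) (mulr_gt0 K0 s0) (divr_gt0 x0 sC0))).
rewrite lee_fin [leRHS]mulrDl [X in _ <= X + _]mulrDl.
apply: lerD; first apply: lerD.
- exact: large_scale_rate.
- apply: ler_pM; [exact: sqrtr_ge0|exact: expR_ge0|exact: sqrt2_le2|].
  rewrite ler_expR; have : rho * L <= L by rewrite ler_piMl// ltW.
  by lra.
apply: (@le_trans _ _ (D * expR (- L))); last first.
  rewrite ler_pM2l// ler_expR; have : rho * L <= L by rewrite ler_piMl// ltW.
  by lra.
apply: (small_scale_rate _ _ _ B _ (kap * x)) => //.
- by rewrite /s expRN -nL -[leLHS]mul1r ler_pM2r ?invr_gt0.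
- apply: (noise_evidence_pow_ge _ _ _ _ K) => //; first exact: ltW.
  by rewrite mulrCA ns.
- have -> : kap * x / 2 = (lambda + 4) * x / sK.
    by rewrite /sK; field; rewrite !gt_eqF.
  apply: signal_evidence_ge => //.
  by rewrite -(ler_pM2l (_ : 0 < 2 :> R))// (le_trans LsK)// mulrCA ler_pM2l//;
    lra.
have kapl : kap <= lambda / sC by rewrite ler_pM2r ?invr_gt0// ge_min lexx.
have kap16 : kap <= 16^-1 / sC by rewrite ler_pM2r ?invr_gt0// ge_min lexx orbT.
have h1 : expR (- lambda * (x / sC)) <= expR (- (kap * x)).
  have -> : - lambda * (x / sC) = - (lambda / sC * x) by ring.
  by rewrite ler_expR lerN2 ler_pM2r.
have h2 : expR (- tnth th0 k ^+ 2 / (16 * (x / sC) * (C * s))) <= expR (- (kap * x)).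
  have -> : - tnth th0 k ^+ 2 / (16 * (x / sC) * (C * s)) = - (16^-1 / sC * x).
    by rewrite Tx -sCC; field; rewrite !gt_eqF.
  by rewrite ler_expR lerN2 ler_pM2r.
have := ler_pM (sqrtr_ge0 2) (expR_ge0 _) sqrt2_le2 h2.
by move: h1; lra.
Qed.
End posterior_rate.

Lemma sparse1_nonzero {R : realType} n (th : vec R n) (k : 'I_n) :
  l0_ball 1 n th -> tnth th k != 0 -> forall j, j != k -> tnth th j = 0.
Proof.
rewrite /l0_ball/= => /card_le1_eqP th1 k0 j jk; apply/eqP/negPn/negP => j0.
by move/negP: jk; apply; apply/eqP/th1; rewrite inE.
Qed.

Lemma norm2_sparse {R : realType} n (th : vec R n) (k : 'I_n) :
  (forall j, j != k -> tnth th j = 0) -> norm2 th ^+ 2 = tnth th k ^+ 2.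
Proof.
move=> thk; rewrite /norm2 sqr_sqrtr; last by apply: sumr_ge0 => i _; exact: sqr_ge0.
by rewrite (bigD1 k)//= big1 ?addr0// => j jk; rewrite thk// expr0n.
Qed.

Lemma norm2_neq0 {R : realType} n (th : vec R n) :
  norm2 th ^+ 2 != 0 -> exists k, tnth th k != 0.
Proof.
move=> th0; apply/existsP; rewrite -negb_forall; apply/negP => /forallP th00.
move/negP: th0; apply; rewrite /norm2 big1 ?sqrtr0 ?expr0n// => i _.
by rewrite (eqP (th00 i)) expr0n.
Qed.

Lemma cvg_expR_ln0 {R : realType} (A d : R) : 0 < d ->
  (A * expR (- d * ln n%:R))%:E @[n --> \oo] --> 0%E.
Proof.
move=> d0; apply: cvg_EFin; first by near=> n.
rewrite -[X in _ --> X](mulr0 A); apply: cvgM; first exact: cvg_cst.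
have lny : (d * ln n%:R : R) @[n --> \oo] --> +oo.
  apply/cvgryPge => B; near=> n.
  rewrite mulrC -ler_pdivrMr// -[leLHS]expRK ler_ln ?posrE ?expR_gt0//.
    by near: n; exact: nbhs_infty_ger.
  by apply: (lt_le_trans (expR_gt0 (B / d))); near: n; exact: nbhs_infty_ger.
have := cvg_comp _ _ lny (@cvgr_expR R).
by apply: cvg_trans; apply: near_eq_cvg; near=> n; rewrite /= mulNr.
Unshelve. all: by end_near. Qed.

Theorem theorem3p7 (R : realType)
  (f : R -> R) (f_class : density_class f)
  (P_tau : probability (measurableTypeR R) R)
  (P_tau_density : forall A : set (measurableTypeR R), measurable A ->
     P_tau A = (\int[lebesgue_measure]_(t in A `&` `]0%R, +oo[) (f t)%:E)%E)
  (lambda : R) (lambda_gt0 : 0 < lambda)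
  (g : probability (measurableTypeR R) R)
  (g_exp : forall A : set (measurableTypeR R), measurable A ->
     g A = exponential_prob lambda A)
  (theta0 : forall n : nat, vec R n)
  (theta0_sparse : forall n : nat, l0_ball 1 n (theta0 n))
  (theta0_large :
     (norm2 (theta0 n) ^+ 2 / ln n%:R) @[n --> \oo] --> +oo) :
  (\int[normal_means (theta0 n)]_y
     posterior (gl_prior P_tau g n) y
       [set theta | (norm2 (subt theta (theta0 n)) <= Num.sqrt (ln n%:R))%R])%E
    @[n --> \oo] --> 0%E.
Proof.
case: f_class => mf f0 _ [M [M0 _ fM]].
have P_pos := density_Nyo0 f P_tau P_tau_density.
have Mi0 : 0 < M^-1 by rewrite invr_gt0.
have P_ge t : 0 < t -> 2 * t < 1 ->
    ((M^-1 * t)%:E <= P_tau (`]t, (2 * t)%R]%classic : set R))%E.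
  apply: (density_itv_ge f P_tau P_tau_density) => //; first exact: ltW.
  by move=> x /fM/ltW.
have [A [d [L0 [d0 L01 rate]]]] :=
  posterior_ball_rate lambda P_tau g lambda_gt0 g_exp P_pos M^-1 Mi0 P_ge.
apply: (@squeeze_cvge _ _ _ _ (cst 0%E) _
  (fun n => (A * expR (- d * ln n%:R))%:E)); last 2 first.
- exact: cvg_cst.
- exact: cvg_expR_ln0.
near=> n.
have Ln : L0 <= ln n%:R.
  rewrite -[leLHS]expRK ler_ln ?posrE ?expR_gt0//.
    by near: n; exact: nbhs_infty_ger.
  by apply: (lt_le_trans (expR_gt0 L0)); near: n; exact: nbhs_infty_ger.
have ln0 : 0 < ln n%:R :> R by apply: lt_le_trans Ln; exact: lt_le_trans L01.
have Tn : 4 * ln n%:R <= norm2 (theta0 n) ^+ 2.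
  rewrite -ler_pdivlMr//; near: n.
  by move/cvgryPge: theta0_large; apply.
(* The signal is nonzero, so it has a nonzero coordinate; by sparsity this one is unique and carries
   the whole norm. *)
have [k k0] : exists k, tnth (theta0 n) k != 0.
  by apply: norm2_neq0; rewrite gt_eqF//; apply: lt_le_trans Tn; rewrite mulr_gt0.
have thk := sparse1_nonzero _ _ _ (theta0_sparse n) k0.
rewrite integral_ge0 => [|y _]; last exact: measure_ge0.
have Tk : 4 * ln n%:R <= tnth (theta0 n) k ^+ 2 by rewrite -(norm2_sparse _ _ _ thk).
exact: rate _ _ _ thk Ln Tk.
Unshelve. all: by end_near. Qed.
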